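(* Let $S_h$ be a natural deformation of the trivial generating function $S_0(p_1,p_2,x)=x(p_1+p_2)$ (in particular $S_h$ satisfies the SGA equation). Then the set $G_h=\mathbb R^{*d}[[h]]\times\mathbb R^d[[h]]$ carries a structure of formal symplectic groupoid over $\mathbb R^d[[h]]$, i.e. the maps $$\epsilon_h(x)=(0,x)\ \text{(unit)},\quad i_h(p,x)=(-p,x)\ \text{(inverse)},\quad s_h(p,x)=\nabla_{p_2}S_h(p,0,x)\ \text{(source)},\quad t_h(p,x)=\nabla_{p_1}S_h(0,p,x)\ \text{(target)}$$ together with the multiplication whose graph is $$G_h^{(m)}=\Big\{\big((p_1,\nabla_{p_1}S_h),(p_2,\nabla_{p_2}S_h),(\nabla_xS_h,x)\big)\Big\}\quad(\text{derivatives evaluated at }(p_1,p_2,x)),$$ satisfy formally the axioms of a groupoid. In particular, if $G_h$ is endowed with the canonical symplectic form, then $G_h^{(m)}$ is formally Lagrangian in $\overline{G_h}\times\overline{G_h}\times G_h$.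
   Context: Notation. $\mathbb R^{*d}$ is the dual of $\mathbb R^d$, $px$ the pairing, $B_n=(\mathbb R^{*d})^n\times\mathbb R^d$. $\nabla_{p_1},\nabla_{p_2},\nabla_x$ denote gradients with respect to the first, second and third argument of a function on $B_2$. Formal series with coefficients in $C^\infty(B_2)$ are evaluated at formal-power-series arguments by Taylor expansion. SGA equation. A formal series $S=\sum_{n\ge0}h^nS_n$, $S_n\in C^\infty(B_2)$, with $S_0(p_1,p_2,x)=x(p_1+p_2)$, satisfies the Symplectic Groupoid Associativity (SGA) equation if, as formal power series in $h$ with coefficients functions of $(p_1,p_2,p_3,x)\in B_3$, $$S(p_1,p_2,\bar x)+S(\bar p,p_3,x)-\bar x\bar p=S(p_2,p_3,\tilde x)+S(p_1,\tilde p,x)-\tilde x\tilde p,$$ where $\bar x,\bar p,\tilde x,\tilde p$ are the formal power series in $h$ uniquely determined by $$\bar x=\nabla_{p_1}S(\bar p,p_3,x),\quad \bar p=\nabla_xS(p_1,p_2,\bar x),\quad \tilde x=\nabla_{p_2}S(p_1,\tilde p,x),\quad \tilde p=\nabla_xS(p_2,p_3,\tilde x).$$ Deformations. A deformation of the trivial generating function is a formal series $S_h=S_0+hS_1+h^2S_2+\cdots$, $S_n\in C^\infty(B_2)$, with $S_0(p_1,p_2,x)=x(p_1+p_2)$, satisfying the SGA equation. It is natural if for all $n\ge1$: (1) $S_n(p,q,x)$ is polynomial in $p$ and $q$; (2) $S_n(\lambda p,\lambda q,x)=\lambda^{n+1}S_n(p,q,x)$; (3) $S_n(p,0,x)=S_n(0,p,x)=0$;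 (4) $S_n^i(p,p,x)=0$ for all $i$, where $S_n^i$ is the part of $S_n$ homogeneous of degree $i$ in the first argument. Groupoid axioms meant: $(g_1,g_2,g)\in G_h^{(m)}$ means $g=g_1g_2$; the product $g_1g_2$ is defined iff $s_h(g_1)=t_h(g_2)$; the product is associative; $t_h(g_1g_2)=t_h(g_1)$, $s_h(g_1g_2)=s_h(g_2)$; $\epsilon_h(t_h(g))g=g$, $g\,\epsilon_h(s_h(g))=g$; $s_h(i_h(g))=t_h(g)$; $i_h(g)g=\epsilon_h(s_h(g))$; $g\,i_h(g)=\epsilon_h(t_h(g))$. $\overline{G_h}$ denotes $G_h$ with the opposite of the canonical form $\omega=\sum_i dp_i\wedge dx^i$. ''Formally Lagrangian'' means that the pullback of $(-\omega)\oplus(-\omega)\oplus\omega$ under the formal parametrization of $G_h^{(m)}$ by $(p_1,p_2,x)$ vanishes (the parametrization having half the dimension of the ambient space). *)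

(* Defs.v *)
From HB Require Import structures.
From mathcomp Require Import all_boot all_order all_algebra.
From mathcomp Require Import all_classical all_reals all_analysis.
From mathcomp Require Import -(notations) mpoly.

Set Implicit Arguments.
Unset Strict Implicit.
Unset Printing Implicit Defensive.

Import Order.TTheory GRing.Theory Num.Theory.
Import numFieldNormedType.Exports.

Local Open Scope ring_scope.

(* A formal power series in h is its sequence of coefficients: the term of
   index n is the coefficient of h^n. *)
Definition fps (V : Type) : Type := nat -> V.

Definition fps_const (V : zmodType) (v : V) : fps V :=
  fun n => if n is 0%N then v else 0.

Definition fps_zero (V : zmodType) : fps V := fun=> 0.

Definition fps_opp (V : zmodType) (a : fps V) : fps V := fun n => - a n.

Section Calculus.
Context {R : realType} {V W : normedModType R}.

Definition dderivs (vs : seq V) (f : V -> W) : V -> W :=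
  foldr (fun v g => fun b => 'D_v g b) f vs.

(* On a finite-dimensional V this is the class C^oo: partial derivatives of all
   orders exist, and they are continuous because they are differentiable. *)
Definition smooth (f : V -> W) : Prop :=
  forall (vs : seq V) (b : V), differentiable (dderivs vs f) b.

(* f (a_0 + u) = \sum_m D^m f (a_0) (u, ..., u) / m! with
   u = \sum_(j >= 1) h^j a_j, expanded by multilinearity: the coefficient of
   h^n collects the m-tuples of positive indices with sum n (so m <= n). *)
Definition taylor (f : V -> W) (a : fps V) : fps W := fun n =>
  \sum_(m < n.+1) (m`!%:R)^-1 *:
    \sum_(k : m.-tuple 'I_n.+1 |
            all (fun j : 'I_n.+1 => (0 < j)%N) k
            && ((\sum_(j <- k) (j : nat))%N == n))
      dderivs [seq a (j : nat) | j : 'I_n.+1 <- k] f (a 0%N).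

Definition fps_eval (F : fps (V -> W)) (a : fps V) : fps W := fun n =>
  \sum_(i < n.+1) taylor (F i) a (n - i)%N.

End Calculus.

(* Row vectors stand for the dual R^{*d}, column vectors for R^d. *)
Definition B2 (R : realType) (d : nat) : normedModType R :=
  ('rV[R]_d * 'rV[R]_d * 'cV[R]_d)%type.

Section GeneratingFunctions.
Context {R : realType} {d : nat}.

Definition pairing (p : 'rV[R]_d) (x : 'cV[R]_d) : R := (p *m x) 0 0.

Definition fps_pairing (p : fps 'rV[R]_d) (x : fps 'cV[R]_d) : fps R :=
  fun n => \sum_(i < n.+1) pairing (p i) (x (n - i)%N).

Definition fps_B2 (p1 p2 : fps 'rV[R]_d) (x : fps 'cV[R]_d) : fps (B2 R d) :=
  fun n => (p1 n, p2 n, x n).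

Definition grad_p1 (f : B2 R d -> R^o) (b : B2 R d) : 'cV[R]_d :=
  \col_i 'D_((delta_mx 0 i, 0, 0) : B2 R d) f b.

Definition grad_p2 (f : B2 R d -> R^o) (b : B2 R d) : 'cV[R]_d :=
  \col_i 'D_((0, delta_mx 0 i, 0) : B2 R d) f b.

Definition grad_x (f : B2 R d -> R^o) (b : B2 R d) : 'rV[R]_d :=
  \row_i 'D_((0, 0, delta_mx i 0) : B2 R d) f b.

Implicit Type S : fps (B2 R d -> R^o).

Definition Sval S (p1 p2 : fps 'rV[R]_d) (x : fps 'cV[R]_d) : fps R :=
  fps_eval S (fps_B2 p1 p2 x).

Definition Sgrad_p1 S (p1 p2 : fps 'rV[R]_d) (x : fps 'cV[R]_d) :
    fps 'cV[R]_d :=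
  fps_eval (fun n => grad_p1 (S n)) (fps_B2 p1 p2 x).

Definition Sgrad_p2 S (p1 p2 : fps 'rV[R]_d) (x : fps 'cV[R]_d) :
    fps 'cV[R]_d :=
  fps_eval (fun n => grad_p2 (S n)) (fps_B2 p1 p2 x).

Definition Sgrad_x S (p1 p2 : fps 'rV[R]_d) (x : fps 'cV[R]_d) :
    fps 'rV[R]_d :=
  fps_eval (fun n => grad_x (S n)) (fps_B2 p1 p2 x).

(* Equality of series with coefficients functions on B_3 is equality at every
   point of B_3.  The four auxiliary series xb, pb, xt, pt are the unique
   solutions of their defining equations: since S_0 is the pairing of p1 + p2
   with x, the right-hand sides determine them recursively in powers of h. *)
Definition SGA S : Prop :=
  forall (p1 p2 p3 : 'rV[R]_d) (x : 'cV[R]_d)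
         (xb xt : fps 'cV[R]_d) (pb pt : fps 'rV[R]_d),
  let c1 := fps_const p1 in let c2 := fps_const p2 in
  let c3 := fps_const p3 in let cx := fps_const x in
  xb = Sgrad_p1 S pb c3 cx ->
  pb = Sgrad_x S c1 c2 xb ->
  xt = Sgrad_p2 S c1 pt cx ->
  pt = Sgrad_x S c2 c3 xt ->
  forall n,
    Sval S c1 c2 xb n + Sval S pb c3 cx n - fps_pairing pb xb n =
    Sval S c2 c3 xt n + Sval S c1 pt cx n - fps_pairing pt xt n.

Record deformation S : Prop := Deformation {
  deformation_smooth : forall n, smooth (S n);
  deformation_S0 : forall (p1 p2 : 'rV[R]_d) (x : 'cV[R]_d),
    S 0%N (p1, p2, x) = pairing (p1 + p2) x;
  deformation_SGA : SGA S }.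

(* The 2d variables are the coordinates of p followed by those of q. *)
Definition eval_pq (P : mpoly (d + d) R) (p q : 'rV[R]_d) : R :=
  meval (fun i => row_mx p q 0 i) P.

Definition poly_at (f : B2 R d -> R) (x : 'cV[R]_d)
    (P : mpoly (d + d) R) : Prop :=
  forall p q : 'rV[R]_d, f (p, q, x) = eval_pq P p q.

Definition fst_homog (i : nat) (P : mpoly (d + d) R) :
    mpoly (d + d) R :=
  \sum_(m <- msupp P | (\sum_(j < d) m (lshift d j))%N == i)
    mcoeff m P *: mpolyX R m.

(* In [natural_diag] the polynomial P is determined by S_n and x, as R is
   infinite; evaluating [fst_homog i P] at (p, q) gives S_n^i (p, q, x). *)
Record natural_deformation S : Prop := NaturalDeformation {
  natural_deformation_of : deformation S;
  natural_poly : forall n, (0 < n)%N ->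
    forall x, exists P, poly_at (S n) x P;
  natural_homog : forall n, (0 < n)%N ->
    forall (lam : R) (p q : 'rV[R]_d) (x : 'cV[R]_d),
      S n (lam *: p, lam *: q, x) = lam ^+ n.+1 * S n (p, q, x);
  natural_vanish : forall n, (0 < n)%N ->
    forall (p : 'rV[R]_d) (x : 'cV[R]_d),
      S n (p, 0, x) = 0 /\ S n (0, p, x) = 0;
  natural_diag : forall n, (0 < n)%N ->
    forall x P, poly_at (S n) x P ->
    forall (i : nat) (p : 'rV[R]_d), eval_pq (fst_homog i P) p p = 0 }.

End GeneratingFunctions.

(* [mul g1 g2 g] is membership of (g1, g2, g) in the graph of the partially
   defined product. *)
Record groupoid_axioms (G X : Type) (eps : X -> G) (inv : G -> G)
    (s t : G -> X) (mul : G -> G -> G -> Prop) : Prop := GroupoidAxioms {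
  groupoid_functional : forall g1 g2 g g',
    mul g1 g2 g -> mul g1 g2 g' -> g = g';
  groupoid_defined : forall g1 g2, (exists g, mul g1 g2 g) <-> s g1 = t g2;
  groupoid_assoc : forall g1 g2 g3 g,
    (exists2 k, mul g1 g2 k & mul k g3 g) <->
    (exists2 k, mul g2 g3 k & mul g1 k g);
  groupoid_target : forall g1 g2 g, mul g1 g2 g -> t g = t g1;
  groupoid_source : forall g1 g2 g, mul g1 g2 g -> s g = s g2;
  groupoid_unitl : forall g, mul (eps (t g)) g g;
  groupoid_unitr : forall g, mul g (eps (s g)) g;
  groupoid_source_inv : forall g, s (inv g) = t g;
  groupoid_invl : forall g, mul (inv g) g (eps (s g));
  groupoid_invr : forall g, mul g (inv g) (eps (t g)) }.

Definition Gh (R : realType) (d : nat) : Type :=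
  (fps 'rV[R]_d * fps 'cV[R]_d)%type.

(* The phase space R^{*d} x R^d, and the ambient space of the graph of the
   product, of dimension 6d. *)
Definition phase (R : realType) (d : nat) : normedModType R :=
  ('rV[R]_d * 'cV[R]_d)%type.

Definition phase3 (R : realType) (d : nat) : normedModType R :=
  (phase R d * phase R d * phase R d)%type.

Section FormalGroupoid.
Context {R : realType} {d : nat}.

Implicit Type S : fps (B2 R d -> R^o).

Definition unit_h (x : fps 'cV[R]_d) : Gh R d := (fps_zero _, x).

Definition inv_h (g : Gh R d) : Gh R d := (fps_opp g.1, g.2).

Definition source_h S (g : Gh R d) : fps 'cV[R]_d :=
  Sgrad_p2 S g.1 (fps_zero _) g.2.

Definition target_h S (g : Gh R d) : fps 'cV[R]_d :=
  Sgrad_p1 S (fps_zero _) g.1 g.2.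

Definition mul_h S (g1 g2 g : Gh R d) : Prop :=
  exists (p1 p2 : fps 'rV[R]_d) (x : fps 'cV[R]_d),
    [/\ g1 = (p1, Sgrad_p1 S p1 p2 x),
        g2 = (p2, Sgrad_p2 S p1 p2 x) &
        g = (Sgrad_x S p1 p2 x, x)].

(* The formal parametrization of the graph of the product by B_2, as a series
   with coefficients functions on B_2; the coordinates p1, p2, x contribute in
   degree 0 only. *)
Definition mul_h_param S : fps (B2 R d -> phase3 R d) := fun n b =>
  ((fps_const b.1.1 n, grad_p1 (S n) b),
   (fps_const b.1.2 n, grad_p2 (S n) b),
   (grad_x (S n) b, fps_const b.2 n)).

(* The canonical form \sum_i dp_i /\ dx^i, at any point. *)
Definition omega (u v : phase R d) : R := pairing u.1 v.2 - pairing v.1 u.2.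

Definition omega3 (u v : phase3 R d) : R :=
  - omega u.1.1 v.1.1 - omega u.1.2 v.1.2 + omega u.2 v.2.

(* The coefficient of h^n, at b and on the tangent vectors u, v, of the
   pullback of the constant form omega3 under F. *)
Definition pullback_omega3 (F : fps (B2 R d -> phase3 R d)) (b u v : B2 R d) :
    fps R := fun n =>
  \sum_(k < n.+1) omega3 ('D_u (F k) b) ('D_v (F (n - k)%N) b).

(* The domain B_2 has dimension 3d, half of that of phase3. *)
Definition formally_lagrangian (F : fps (B2 R d -> phase3 R d)) : Prop :=
  forall (b u v : B2 R d) (n : nat), pullback_omega3 F b u v n = 0.

End FormalGroupoid.

(* Main.v *)
From HB Require Import structures.
Require Import Defs.
From mathcomp Require Import all_boot all_order all_algebra.
From mathcomp Require Import all_classical all_reals all_analysis.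
From mathcomp Require Import ring lra.
From mathcomp Require Import -(notations) mpoly.

(* Write theta = h d/dh.  As partial derivatives commute, the Taylor expansion of
   f at a formal point a satisfies
     theta (f(a)) = \sum_i theta(a_i) (d_i f)(a),
   and this recursion together with the constant term f(a_0) determines f(a).
   Induction on the power of h then yields multiplicativity, the chain rule, and
   the associativity of formal substitution.

   At constant arguments xb, pb, xt, pt are fixed points of h-adic contractions
   preserving smoothness, hence have smooth coefficients, and they are critical
   points of the two sides of the SGA equation.  Differentiating that equation
   in p1, p2, p3, x therefore gives four identities between first derivatives of
   S, which remain valid at formal arguments by substitution.  They say exactly
   that the two ways of multiplying three elements agree.  The other axioms are
   the special cases where some p_i vanishes or (p1, p2, p3) = (p, -p, p), since
   S_n vanishes for n >= 1 at (p, 0, x), (0, p, x) and, by naturality, (p, -p, x).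
   The graph is Lagrangian because the Hessian of S is symmetric. *)

Set Implicit Arguments.
Unset Strict Implicit.
Unset Printing Implicit Defensive.

Import Order.TTheory GRing.Theory Num.Theory.
Import numFieldNormedType.Exports.

Local Open Scope ring_scope.

(** * Symmetry of second derivatives *)

Section Derive.
Context {R : realType}.
Implicit Types U V W : normedModType R.

(** The SGA equation is assumed at constant arguments only, whereas [Gh] consists of formal series.
    The auxiliary series are therefore treated as families over B_3, where p1, p2, p3, x are
    parameters constant in h, and a formal point of B_3 is inserted at the very end. Hence both
    differentiation in parameters and substitution at formal points are needed for families.
    [taylor] nests directional derivatives along the coefficients of the argument, so comparing two
    expansions requires permuting derivatives; this is why their symmetry comes first. In the
    recursion for theta the factors theta(a_i) have no constant term, so each use gains one power of
    h. The contractions come from S_0 = (p1 + p2) x: its p-gradients do not involve p and its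
    x-gradient does not involve x, so such dependence first enters with a factor h. Naturality acts
    through linear subspaces: where S_n vanishes on one, its derivatives along tangent directions
    vanish too. On p2 = 0 and p1 = 0 this leaves only S_0 in the tangential gradients; on p1 + p2 =
    0 it gives a zero x-gradient and equal p-gradients. *)

Lemma derive_comp U V W (g : U -> V) (f : V -> W) b w :
  differentiable g b -> differentiable f (g b) ->
  'D_w (f \o g) b = 'D_('D_w g b) f (g b).
Proof.
move=> dg df; rewrite deriveE; last exact: differentiable_comp.
by rewrite diff_comp //= -deriveE // -deriveE.
Qed.

Lemma derive_along_line V W (f : V -> W) (a u : V) (s : R^o) :
  differentiable f (a + s *: u) ->
  is_derive s (1 : R^o) (fun r : R^o => f (a + r *: u)) ('D_u f (a + s *: u)).
Proof.
move=> df.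
have dg : is_diff s (fun r : R^o => a + r *: u) (fun r : R^o => r *: u).
  have -> : (fun r : R^o => r *: u) = 0 + (fun r : R^o => r *: u).
    by apply/funext => r; rewrite /= fctE add0r.
  exact: is_diffD.
have dfg : differentiable (fun r : R^o => f (a + r *: u)) s.
  by apply: (differentiable_comp (f := fun r : R^o => a + r *: u)).
apply: DeriveDef; first exact: diff_derivable.
rewrite (derive_comp (g := fun r : R^o => a + r *: u)) //.
by rewrite [X in 'D_X f _]deriveE // diff_val scale1r.
Qed.

Lemma differentiable_near V (f : V -> R^o) a : differentiable f a ->
  forall e : R, 0 < e -> exists2 d : R, 0 < d &
    forall y, `|y| < d -> `|f (a + y) - f a - 'd f a y| <= e * `|y|.
Proof.
move=> df e e0.
have /eqaddoP /(_ e e0) /nbhs_ballP [d /= d0 H] := diff_locally df.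
exists d => // y yd.
have := H y; rewrite -ball_normE /= sub0r normrN => /(_ yd).
rewrite /= !fctE; congr (`|_| <= _).
by rewrite [y + a]addrC opprD addrA.
Qed.

(** The mean value theorem in the direction u turns the second difference into t times a difference
    of ['D_u f] at two points near a. Differentiability of ['D_u f] at a expands both values; their
    linear parts differ by t ['D_v ('D_u f) a]. *)
Lemma second_difference V (f : V -> R^o) (a u v : V) :
  (forall x, differentiable f x) -> differentiable ('D_u f : V -> R^o) a ->
  forall e : R, 0 < e -> exists2 d : R, 0 < d & forall t : R, 0 < t < d ->
  `|f (a + t *: u + t *: v) - f (a + t *: u) - f (a + t *: v) + f a
     - t ^+ 2 * 'D_v ('D_u f) a| <= e * t ^+ 2.
Proof.
move=> df dfu e e0.
(* For 0 < c < t the displacements c u and t v + c u have norm at most t M. Each of the two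
   remainders is allowed half of e t, hence the tolerance e / (2 M). *)
pose M := `|u| + `|v| + 1.
have M0 : 0 < M by rewrite /M; have := normr_ge0 u; have := normr_ge0 v; lra.
have e'0 : 0 < e / (2 * M) by rewrite divr_gt0 // mulr_gt0.
have [d d0 H] := differentiable_near dfu e'0.
exists (d / M); first by rewrite divr_gt0.
move=> t /andP[t0]; rewrite ltr_pdivlMr // => td.
pose g (s : R^o) : R^o := f (a + t *: v + s *: u) - f (a + s *: u).
pose dg (s : R^o) : R^o := 'D_u f (a + t *: v + s *: u) - 'D_u f (a + s *: u).
have gdg (s : R^o) : is_derive s (1 : R^o) g (dg s).
  by apply: is_deriveB; apply: derive_along_line.
have [|] := @MVT _ g dg 0 t t0 (fun s _ => gdg s).
  apply: continuous_subspaceT => s.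
  apply: differentiable_continuous; apply/derivable1_diffP.
  by have [] := gdg s.
move=> c; rewrite in_itv /= subr0 => /andP[c0 ct] Eg.
have -> : f (a + t *: u + t *: v) - f (a + t *: u) - f (a + t *: v) + f a =
   g t - g 0.
  rewrite /g scale0r !addr0 [a + t *: v + _]addrAC.
  set F1 := f (a + _ + _); set F2 := f (a + t *: u); set F3 := f (a + _); set F4 := f a.
  by rewrite opprB addrA [_ + F4]addrC; ring.
rewrite Eg expr2.
have -> : dg c * t - t * t * 'D_v ('D_u f) a =
  t * (dg c - t * 'D_v ('D_u f) a) by ring.
rewrite normrM (gtr0_norm t0) mulrCA ler_pM2l //.
have cuM : `|c *: u| <= t * M.
  rewrite normrZ (gtr0_norm c0) ler_pM // ?ltW //.
  by rewrite /M; have := normr_ge0 v; lra.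
have cvM : `|t *: v + c *: u| <= t * M.
  apply: (le_trans (ler_normD _ _)).
  rewrite !normrZ (gtr0_norm c0) (gtr0_norm t0) /M.
  have : c * `|u| <= t * `|u| by rewrite ler_wpM2r // ltW.
  lra.
have H1 := H _ (le_lt_trans cuM td); have H2 := H _ (le_lt_trans cvM td).
have -> : dg c - t * 'D_v ('D_u f) a =
   ('D_u f (a + (t *: v + c *: u)) - 'D_u f a -
     'd ('D_u f : V -> R^o) a (t *: v + c *: u)) -
   ('D_u f (a + c *: u) - 'D_u f a - 'd ('D_u f : V -> R^o) a (c *: u)).
  have -> : 'd ('D_u f : V -> R^o) a (t *: v + c *: u) =
      t * 'D_v ('D_u f) a + 'd ('D_u f : V -> R^o) a (c *: u).
    by rewrite linearD linearZ /= -deriveE.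
  by rewrite /dg !addrA; ring.
apply: (le_trans (ler_normB _ _)).
have E : e * t = e / (2 * M) * (t * M) + e / (2 * M) * (t * M).
  by field; rewrite gt_eqF.
rewrite E; apply: lerD.
  by apply: (le_trans H2); rewrite ler_pM2l.
by apply: (le_trans H1); rewrite ler_pM2l.
Qed.

(** The second difference is symmetric in u and v, and after division by t^2 it is arbitrarily close
    to either mixed derivative. *)
Lemma derive_swap V (f : V -> R^o) (a u v : V) :
  (forall x, differentiable f x) -> differentiable ('D_u f : V -> R^o) a ->
  differentiable ('D_v f : V -> R^o) a ->
  'D_u ('D_v f) a = 'D_v ('D_u f) a.
Proof.
move=> df du dv; apply/eqP; rewrite -subr_eq0 -normr_eq0 eq_le normr_ge0 andbT.
apply/ler_addgt0Pr => e e0; rewrite add0r.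
have e20 : 0 < e / 2 by rewrite divr_gt0.
have [d1 d10 H1] := second_difference v df du e20.
have [d2 d20 H2] := second_difference u df dv e20.
pose t := Num.min d1 d2 / 2.
have m0 : 0 < Num.min d1 d2 by rewrite lt_min d10.
have t0 : 0 < t by rewrite divr_gt0.
have tm : t < Num.min d1 d2 by rewrite /t; lra.
have td1 : 0 < t < d1 by rewrite t0 (lt_le_trans tm) // ge_min lexx.
have td2 : 0 < t < d2 by rewrite t0 (lt_le_trans tm) // ge_min lexx orbT.
have {}H1 := H1 t td1; have {}H2 := H2 t td2.
rewrite -(ler_pM2l (exprn_gt0 2 t0)) -[X in X * `|_|]gtr0_norm ?exprn_gt0 //.
rewrite -normrM.
set A := f _ - _ - _ + _ in H1.
have {}H2 : `|A - t ^+ 2 * 'D_u ('D_v f) a| <= e / 2 * t ^+ 2.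
  move: H2; congr (`| _ - _| <= _).
  by rewrite /A [a + t *: v + _]addrAC; ring.
move: ('D_u ('D_v f) a) ('D_v ('D_u f) a) H1 H2 => p q H1 H2.
have -> : t ^+ 2 * (p - q) = (A - t ^+ 2 * q) - (A - t ^+ 2 * p).
  by rewrite mulrBr opprB [RHS]addrC addrA subrK.
apply: (le_trans (ler_normB _ _)).
apply: (le_trans (lerD H1 H2)).
by rewrite -mulrDl -splitr mulrC.
Qed.

End Derive.

(** * Smooth functions and coordinates *)

Section Smooth.
Context {R : realType}.
Implicit Types U V W : normedModType R.

Lemma differentiable_bigsum V W (I : finType) (h : I -> V -> W) x :
  (forall i, differentiable (h i) x) ->
  differentiable (fun y => \sum_i h i y) x.
Proof.
move=> dh; rewrite -fct_sumE; elim/big_ind: _ => //.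
  by move=> f g; apply: differentiableD.
Qed.

(** A finite-order form of [smooth] that peels off the derivative taken first. Induction on the
    order closes under the product and chain rules, which differentiate one factor at a time and
    leave sums of products. *)
Fixpoint Ck V (k : nat) (f : V -> R^o) : Prop :=
  (forall b, differentiable f b) /\
  if k is k'.+1 then forall v, Ck k' ('D_v f) else True.

Lemma Ck_diff V k (f : V -> R^o) b : Ck k f -> differentiable f b.
Proof. by case: k => [|k] []. Qed.

Lemma CkW V k (f : V -> R^o) : Ck k.+1 f -> Ck k f.
Proof.
elim: k f => [|k IH] f; first by case.
by case=> df Df; split=> // v; apply: IH; apply: Df.
Qed.

Lemma smoothP V (f : V -> R^o) : smooth f <-> forall k, Ck k f.
Proof.
split=> [sf k|Cf vs].
  elim: k f sf => [|k IH] f sf; first by split=> // b; apply: (sf [::]).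
  split=> [b|v]; first by apply: (sf [::]).
  apply: IH => vs b; have := sf (rcons vs v) b.
  by rewrite /dderivs foldr_rcons.
elim: {vs}(size vs) {-2}vs (erefl (size vs)) f Cf => [|n IH] vs.
  by move/size0nil => -> f Cf b; have [] := Cf 0%N.
case/lastP: vs => [//|vs v]; rewrite size_rcons => -[sz] f Cf b.
rewrite /dderivs foldr_rcons; apply: (IH vs sz ('D_v f)) => k.
by have [_ ] := Cf k.+1; apply.
Qed.

Lemma Ck_cst V k (a : R) : Ck k (fun _ : V => a : R^o).
Proof.
elim: k a => [|k IH] a; (split; first by move=> b; exact: differentiable_cst).
  by [].
move=> v.
by rewrite (_ : 'D_v _ = fun=> 0) //; apply/funext => b; exact: derive_cst.
Qed.

Lemma CkD V k (f g : V -> R^o) : Ck k f -> Ck k g ->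
  Ck k (fun b => f b + g b).
Proof.
elim: k f g => [|k IH] f g Cf Cg; (split; first by
    move=> b; apply: differentiableD; apply: Ck_diff; eassumption).
  by [].
move=> v.
rewrite (_ : 'D_v _ = fun b => 'D_v f b + 'D_v g b).
  by apply: IH; [apply: (proj2 Cf) | apply: (proj2 Cg)].
by apply/funext => b; apply: deriveD; apply: diff_derivable; apply: Ck_diff;
  eassumption.
Qed.

Lemma derive_mul V (f g : V -> R^o) b v :
  differentiable f b -> differentiable g b ->
  'D_v (fun x => f x * g x : R^o) b = 'D_v f b * g b + f b * 'D_v g b.
Proof.
move=> df dg; rewrite deriveM; try exact: diff_derivable.
by rewrite addrC mulrC.
Qed.

Lemma CkM V k (f g : V -> R^o) : Ck k f -> Ck k g ->
  Ck k (fun b => f b * g b : R^o).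
Proof.
elim: k f g => [|k IH] f g Cf Cg; (split; first by
    move=> b; apply: differentiableM; apply: Ck_diff; eassumption).
  by [].
move=> v.
rewrite (_ : 'D_v _ = fun b => 'D_v f b * g b + f b * 'D_v g b).
  by apply: CkD; apply: IH; (try exact: CkW); [apply: (proj2 Cf) | apply: (proj2 Cg)].
by apply/funext => b; apply: derive_mul; apply: Ck_diff; eassumption.
Qed.

Lemma smooth_diff V (f : V -> R^o) : smooth f -> forall b, differentiable f b.
Proof. by move=> sf; apply: (sf [::]). Qed.

Lemma smooth_derive V (f : V -> R^o) v : smooth f -> smooth ('D_v f : V -> R^o).
Proof. by move=> /smoothP sf; apply/smoothP => k; have [_] := sf k.+1; apply. Qed.

Lemma smooth_cst V (a : R) : smooth (fun _ : V => a : R^o).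
Proof. by apply/smoothP => k; apply: Ck_cst. Qed.

Lemma smoothD V (f g : V -> R^o) : smooth f -> smooth g ->
  smooth (fun b => f b + g b).
Proof. by move=> /smoothP sf /smoothP sg; apply/smoothP => k; apply: CkD. Qed.

Lemma smoothM V (f g : V -> R^o) : smooth f -> smooth g ->
  smooth (fun b => f b * g b : R^o).
Proof. by move=> /smoothP sf /smoothP sg; apply/smoothP => k; apply: CkM. Qed.

Lemma smoothN V (f : V -> R^o) : smooth f -> smooth (fun b => - f b).
Proof.
move=> sf; rewrite (_ : (fun b => _) = (fun b => (-1) * f b : R^o)).
  by apply: smoothM => //; apply: smooth_cst.
by apply/funext => b; rewrite mulN1r.
Qed.

Lemma smoothB V (f g : V -> R^o) : smooth f -> smooth g ->
  smooth (fun b => f b - g b).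
Proof. by move=> sf sg; apply: smoothD => //; apply: smoothN. Qed.

Lemma smooth_sum V I (r : seq I) (P : pred I) (h : I -> V -> R^o) :
  (forall i, smooth (h i)) -> smooth (fun y => \sum_(i <- r | P i) h i y).
Proof.
move=> sh; rewrite -fct_sumE; elim/big_ind: _ => //; first exact: smooth_cst.
by move=> f g; apply: smoothD.
Qed.

Lemma derive_linear V (W : normedModType R) (f : {linear V -> W}) b v :
  continuous f -> 'D_v f b = f v.
Proof.
move=> cf; rewrite deriveE; last exact: linear_differentiable.
by rewrite diff_lin.
Qed.

Lemma smooth_linear V (f : {linear V -> R^o}) : continuous f -> smooth f.
Proof.
move=> cf; apply/smoothP => k.
case: k => [|k]; (split; first by move=> b; exact: linear_differentiable).
  by [].
move=> v.
rewrite (_ : 'D_v f = fun=> f v); first exact: Ck_cst.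
by apply/funext => b; apply: derive_linear.
Qed.

Lemma derive_smooth_swap V (f : V -> R^o) u v : smooth f ->
  'D_u ('D_v f) = 'D_v ('D_u f).
Proof.
move=> sf; apply/funext => b; apply: derive_swap.
- exact: smooth_diff.
- by apply: smooth_diff; apply: smooth_derive.
- by apply: smooth_diff; apply: smooth_derive.
Qed.

End Smooth.

(** A finite frame with its coordinate functionals. It lets one chain rule, a finite sum over
    partial derivatives, serve row and column vectors, B_2 and B_3 alike. *)
Record coordinates (R : realType) (V : normedModType R) := Coordinates {
  cidx : finType;
  cvec : cidx -> V;
  ccoord : cidx -> {linear V -> R^o};
  ccoord_continuous : forall i, continuous (ccoord i);
  ccoordE : forall v, v = \sum_i ccoord i v *: cvec i }.

Section Coordinates.
Context {R : realType} {V : normedModType R} (e : coordinates V).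

Lemma smooth_coord (i : cidx e) : smooth (ccoord i).
Proof. exact/smooth_linear/ccoord_continuous. Qed.

Lemma derive_coord (f : V -> R^o) b v : differentiable f b ->
  'D_v f b = \sum_(i : cidx e) ccoord i v * 'D_(cvec i) f b.
Proof.
move=> df; rewrite deriveE // {1}(ccoordE e v) linear_sum.
by apply: eq_bigr => i _; rewrite linearZ /= -deriveE.
Qed.

Lemma differentiable_coords (U : normedModType R) (A : U -> V) b :
  (forall i : cidx e, differentiable (fun u => ccoord i (A u)) b) ->
  differentiable A b.
Proof.
move=> dA; rewrite (_ : A = fun u => \sum_(i : cidx e) ccoord i (A u) *: cvec i).
  by apply: differentiable_bigsum => i; apply: differentiableZl.
by apply/funext => u; rewrite -ccoordE.
Qed.

Lemma derive_comp_coord (U : normedModType R) (A : U -> V) (f : V -> R^o) b w :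
  (forall i : cidx e, differentiable (fun u => ccoord i (A u)) b) ->
  differentiable f (A b) ->
  'D_w (fun u => f (A u)) b =
  \sum_(i : cidx e) 'D_w (fun u => ccoord i (A u)) b * 'D_(cvec i) f (A b).
Proof.
move=> dA df; have dA' := differentiable_coords dA.
rewrite (derive_comp (g := A)) // derive_coord //.
apply: eq_bigr => i _; congr (_ * _).
rewrite -(derive_linear (A b)); last exact: ccoord_continuous.
apply/esym/(derive_comp (g := A)) => //.
exact/linear_differentiable/ccoord_continuous.
Qed.

(** By the chain rule a derivative of the composite is a sum of products of smooth functions with
    partial derivatives of f composed with A, to which the induction on the order applies. *)
Lemma smooth_comp (U : normedModType R) (A : U -> V) (f : V -> R^o) :
  (forall i : cidx e, smooth (fun u => ccoord i (A u) : R^o)) -> smooth f ->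
  smooth (fun u => f (A u)).
Proof.
move=> sA sf; apply/smoothP => k.
have dA b : differentiable A b.
  by apply: differentiable_coords => i; apply: smooth_diff.
elim: k f sf => [|k IH] f sf; (split; first by move=> b;
    apply: (differentiable_comp (f := A)) => //; exact: smooth_diff).
  by [].
move=> v.
rewrite (_ : 'D_v _ = fun b => \sum_(i : cidx e)
  ('D_v (fun u => ccoord i (A u)) b * 'D_(cvec i) f (A b) : R^o)).
  rewrite -fct_sumE; elim/big_ind: _ => //; first exact: Ck_cst.
    by move=> g h; apply: CkD.
  move=> i _; apply: CkM.
    by have /smoothP := smooth_derive v (sA i); apply.
  by apply: (IH ('D_(cvec i) f)); apply: smooth_derive.
apply/funext => b; apply: derive_comp_coord => [i|]; exact: smooth_diff.
Qed.

End Coordinates.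

(** * Formal power series *)

(** Congruence modulo h^N. *)
Definition eqm (T : Type) (N : nat) (a b : fps T) :=
  forall n, (n < N)%N -> a n = b n.

Section FpsRing.
Context {K : comNzRingType}.
Implicit Types a b c : fps K.

HB.instance Definition _ := gen_eqMixin (fps K).
HB.instance Definition _ := gen_choiceMixin (fps K).

Definition fps_add a b : fps K := fun n => a n + b n.
Definition fps_mul a b : fps K := fun n => \sum_(i < n.+1) a i * b (n - i)%N.

Lemma fps_addA : associative fps_add.
Proof. by move=> a b c; apply/funext => n; rewrite /fps_add addrA. Qed.
Lemma fps_addC : commutative fps_add.
Proof. by move=> a b; apply/funext => n; rewrite /fps_add addrC. Qed.
Lemma fps_add0 : left_id (fps_zero K) fps_add.
Proof. by move=> a; apply/funext => n; rewrite /fps_add add0r. Qed.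
Lemma fps_addN : left_inverse (fps_zero K) (@fps_opp K) fps_add.
Proof. by move=> a; apply/funext => n; rewrite /fps_add addNr. Qed.

HB.instance Definition _ := GRing.isZmodule.Build (fps K)
  fps_addA fps_addC fps_add0 fps_addN.

(* The ring laws are inherited from polynomials by truncation. *)
Definition fps_trunc N a : {poly K} := \poly_(i < N) a i.

Lemma fps_mul_trunc N a b n : (n < N)%N ->
  fps_mul a b n = (fps_trunc N a * fps_trunc N b)`_n.
Proof.
move=> nN; rewrite coefM; apply: eq_bigr => i _.
rewrite !coef_poly.
have iN : (i < N)%N by apply: leq_ltn_trans nN; rewrite -ltnS.
by rewrite iN (leq_ltn_trans (leq_subr _ _) nN).
Qed.

Lemma fps_mulC : commutative fps_mul.
Proof.
move=> a b; apply/funext => n.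
by rewrite !(@fps_mul_trunc n.+1) // mulrC.
Qed.

Lemma fps_mulA : associative fps_mul.
Proof.
move=> a b c; apply/funext => n.
transitivity ((fps_trunc n.+1 a * (fps_trunc n.+1 b * fps_trunc n.+1 c))`_n).
  rewrite coefM; apply: eq_bigr => i _; rewrite coef_poly ltn_ord.
  by rewrite (@fps_mul_trunc n.+1) // ltnS leq_subr.
rewrite mulrA coefM; apply: eq_bigr => i _.
by rewrite (@fps_mul_trunc n.+1) // coef_poly ltnS leq_subr.
Qed.

Lemma fps_mul1 : left_id (fps_const (1 : K)) fps_mul.
Proof.
move=> a; apply/funext => n; rewrite /fps_mul big_ord_recl /= mul1r subn0.
by rewrite big1 ?addr0 // => i _; rewrite mul0r.
Qed.

Lemma fps_mulDl : left_distributive fps_mul fps_add.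
Proof.
move=> a b c; apply/funext => n; rewrite /fps_mul /fps_add -big_split /=.
by apply: eq_bigr => i _; rewrite mulrDl.
Qed.

Lemma fps_one_neq0 : fps_const (1 : K) != fps_zero K.
Proof. by apply/eqP => /(congr1 (@^~ 0%N)) /eqP; rewrite oner_eq0. Qed.

HB.instance Definition _ := GRing.Zmodule_isComNzRing.Build (fps K)
  fps_mulA fps_mulC fps_mul1 fps_mulDl fps_one_neq0.

Lemma fpsD a b n : (a + b) n = a n + b n. Proof. by []. Qed.
Lemma fpsMn a k n : (a *+ k) n = a n *+ k.
Proof. by elim: k => // k IH; rewrite !mulrS fpsD IH. Qed.
Lemma fpsM a b n : (a * b) n = \sum_(i < n.+1) a i * b (n - i)%N.
Proof. by []. Qed.
Lemma fps_sum I (r : seq I) (P : pred I) (F : I -> fps K) n :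
  (\sum_(i <- r | P i) F i) n = \sum_(i <- r | P i) F i n.
Proof. by elim/big_rec2: _ => // i x y _ <-. Qed.

Lemma fps_coef0M a b : (a * b) 0%N = a 0%N * b 0%N.
Proof. by rewrite fpsM big_ord1. Qed.

Lemma fps_constM (k : K) a n : (fps_const k * a) n = k * a n.
Proof.
rewrite fpsM big_ord_recl /= subn0 big1 ?addr0 // => i _.
by rewrite mul0r.
Qed.

Definition fps_h : fps K := fun n => (n == 1%N)%:R.

Lemma fps_hM a n : (fps_h * a) n = if n is m.+1 then a m else 0.
Proof.
rewrite fpsM; case: n => [|n]; first by rewrite big_ord1 mul0r.
rewrite big_ord_recl mul0r add0r big_ord_recl /= mul1r subn1 /=.
by rewrite big1 ?addr0 // => i _; rewrite mul0r.
Qed.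

Lemma fps_hXM k a n : (fps_h ^+ k * a) n = if (k <= n)%N then a (n - k)%N else 0.
Proof.
elim: k a n => [|k IH] a n; first by rewrite mul1r subn0.
rewrite exprS -mulrA fps_hM.
by case: n => [|n] //; rewrite IH ltnS subSS.
Qed.

Lemma eqmM N a b c d : eqm N a b -> eqm N c d -> eqm N (a * c) (b * d).
Proof.
move=> ab cd n nN; rewrite !fpsM; apply: eq_bigr => i _.
rewrite ab ?cd //; first exact: leq_ltn_trans (leq_subr _ _) nN.
by apply: leq_ltn_trans nN; rewrite -ltnS.
Qed.

Lemma eqm_sum N I (r : seq I) (F G : I -> fps K) :
  (forall i, eqm N (F i) (G i)) -> eqm N (\sum_(i <- r) F i) (\sum_(i <- r) G i).
Proof.
by move=> FG n nN; rewrite !fps_sum; apply: eq_bigr => i _; apply: FG.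
Qed.

(** A factor divisible by h gains one order of precision. With theta(a_i) as the factor, this is the
    inductive step of all later comparisons of series. *)
Lemma eqmMS N a b c : a 0%N = 0 -> eqm N b c -> eqm N.+1 (a * b) (a * c).
Proof.
move=> a0 bc n nN; rewrite !fpsM !big_ord_recl a0 !mul0r; congr (_ + _).
apply: eq_bigr => i _; rewrite bc // lift0.
rewrite ltnS in nN; apply: leq_trans nN.
by case: n i => [[]//|n] i; rewrite subSS ltnS leq_subr.
Qed.

(* The Euler operator h d/dh. *)
Definition euler a : fps K := fun n => a n *+ n.

Lemma eulerD a b : euler (a + b) = euler a + euler b.
Proof. by apply/funext => n; rewrite /euler fpsD mulrnDl. Qed.

Lemma euler_sum I (r : seq I) (F : I -> fps K) :
  euler (\sum_(i <- r) F i) = \sum_(i <- r) euler (F i).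
Proof.
by apply/funext => n; rewrite /euler !fps_sum -sumrMnl.
Qed.

Lemma eulerM a b : euler (a * b) = euler a * b + a * euler b.
Proof.
apply/funext => n; rewrite /euler fpsD !fpsM -big_split /= -sumrMnl.
apply: eq_bigr => i _; rewrite mulrnAl mulrnAr -mulrnDr subnKC //.
by rewrite -ltnS.
Qed.

Lemma euler_const (k : K) : euler (fps_const k) = 0.
Proof. by apply/funext => -[|n]; rewrite /euler //= mul0rn. Qed.

End FpsRing.

(** In characteristic zero n a_n determines a_n for n > 0; the constant term, killed by theta, is
    compared separately. *)
Lemma eqm_euler (K : numDomainType) N (a b : fps K) :
  a 0%N = b 0%N -> eqm N (euler a) (euler b) -> eqm N a b.
Proof.
move=> ab0 ab [|n] // /ab /eqP; rewrite /euler.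
by rewrite -subr_eq0 -mulrnBl mulrn_eq0 /= subr_eq0 => /eqP.
Qed.

(** * Taylor expansion at a formal point *)

Section TaylorRecursion.
Context {R : realType} {V : normedModType R} (e : coordinates V).
Implicit Types (f g : V -> R^o) (a : fps V).

Lemma smooth_dderivs vs f : smooth f -> smooth (dderivs vs f).
Proof. by move=> sf us b; rewrite /dderivs -foldr_cat; apply: (sf (us ++ vs)). Qed.

Lemma dderivs_derive vs f u b : smooth f ->
  'D_u (dderivs vs f) b = dderivs vs ('D_u f) b.
Proof.
move=> sf; elim: vs b => [//|v vs IH] b.
have E : 'D_u (dderivs vs f) = dderivs vs ('D_u f) by apply/funext.
transitivity ('D_v ('D_u (dderivs vs f)) b); last by rewrite E.
exact: (congr1 (@^~ b) (derive_smooth_swap u v (smooth_dderivs vs sf))).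
Qed.

(** The outermost direction is expanded in coordinates and its partial derivatives are commuted to
    the innermost place, which yields the shape of the recursion in [taylor_part]. *)
Lemma dderivs_cons v vs f b : smooth f ->
  dderivs (v :: vs) f b =
  \sum_(i : cidx e) ccoord i v * dderivs vs ('D_(cvec i) f : V -> R^o) b.
Proof.
move=> sf; rewrite -[LHS]/('D_v (dderivs vs f) b) (derive_coord e);
  last exact/smooth_diff/smooth_dderivs.
by apply: eq_bigr => i _; rewrite dderivs_derive.
Qed.

Definition coord_series (i : cidx e) a : fps R := fun n => ccoord i (a n).

(** The coordinate of the increment u = a - a_0 in the Taylor expansion. *)
Definition coord_series0 (i : cidx e) a : fps R :=
  fun n => if n is 0%N then 0 else ccoord i (a n).

Lemma euler_coord_series0 i a :
  euler (coord_series0 i a) = euler (coord_series i a).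
Proof. by apply/funext => -[|n]. Qed.

(* The order-m part of the Taylor expansion, times m!. *)
Fixpoint taylor_part (m : nat) f a : fps R :=
  if m is m'.+1 then
    \sum_i coord_series0 i a * taylor_part m' ('D_(cvec i) f) a
  else fps_const (f (a 0%N)).

(** The inner sum of [taylor]. The index bound N is kept apart from the degree n, because removing
    the head of a tuple lowers n but not the index type. *)
Definition tuple_part N m n f a : R :=
  \sum_(k : m.-tuple 'I_N |
          all (fun j : 'I_N => (0 < j)%N) k
          && ((\sum_(j <- k) (j : nat))%N == n))
      dderivs [seq a (j : nat) | j : 'I_N <- k] f (a 0%N).

Lemma tuple_partE N m n f a : smooth f -> (n < N)%N ->
  tuple_part N m n f a = taylor_part m f a n.
Proof.
move=> sf nN; elim: m n nN f sf => [|m IH] n nN f sf.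
  rewrite /tuple_part /=; case: n nN => [|n] nN.
    rewrite (big_pred1 [tuple]) // => k.
    by transitivity true; [rewrite tuple0 /= big_nil | apply/esym/eqP/tuple0].
  by rewrite big_pred0 // => k; rewrite tuple0 /= big_nil.
(* The head j of the tuple is split off; the remaining indices sum to n - j, which forces j <= n. *)
have -> : tuple_part N m.+1 n f a =
  \sum_(j : 'I_N | (0 < j)%N && (j <= n)%N)
    \sum_(k : m.-tuple 'I_N |
          all (fun j : 'I_N => (0 < j)%N) k
          && ((\sum_(j <- k) (j : nat))%N == n - j)%N)
      dderivs (a j :: [seq a (j : nat) | j : 'I_N <- k]) f (a 0%N).
  rewrite pair_big_dep /=.
  rewrite /tuple_part (reindex (fun p : 'I_N * m.-tuple 'I_N => cons_tuple p.1 p.2)) /=.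
    apply: eq_bigl => -[j k] /=; rewrite big_cons -!andbA; congr andb.
    rewrite [RHS]andbCA; congr andb.
    set s := (\sum_(_ <- _) _)%N.
    case: (leqP j n) => jn /=; first by rewrite -(eqn_add2l j s) subnKC.
    by apply/negbTE; rewrite neq_ltn orbC (leq_trans jn) // leq_addr.
  exists (fun t => (thead t, [tuple of behead t])) => [[j k] _|t _] /=.
    by rewrite theadE; congr pair; apply: val_inj.
  by apply: val_inj; rewrite [t in RHS]tuple_eta.
under eq_bigr do under eq_bigr do rewrite dderivs_cons //.
under eq_bigr do rewrite exchange_big /=.
rewrite exchange_big /= fps_sum; apply: eq_bigr => i _.
rewrite fpsM (big_ord_widen N (fun j => coord_series0 i a j *
  taylor_part m ('D_(cvec i) f) a (n - j)%N)) //.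
rewrite big_mkcond [RHS]big_mkcond; apply: eq_bigr => j _.
rewrite ltnS; case: (posnP j) => [-> /=|j0 /=]; first by rewrite mul0r.
case: ifP => // jn; rewrite -mulr_sumr -IH; last exact: smooth_derive.
  by rewrite /coord_series0; case: (nat_of_ord j) j0.
exact: leq_ltn_trans (leq_subr _ _) nN.
Qed.

(** The order-m part is a sum of products with m factors divisible by h. *)
Lemma taylor_part_small m f a n : (n < m)%N -> taylor_part m f a n = 0.
Proof.
elim: m n f => [//|m IH] n f nm; rewrite /= fps_sum big1 // => i _.
rewrite fpsM big1 // => -[[|j] /= jn] _; first by rewrite mul0r.
by rewrite IH ?mulr0 //; case: n nm jn => // n; rewrite subSS !ltnS => nm jn;
  apply: leq_ltn_trans (leq_subr _ _) nm.
Qed.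

(** Orders m > n contribute nothing to degree n, so a single bound N serves all degrees below N. *)
Lemma taylorE N f a n : smooth f -> (n < N)%N ->
  taylor f a n = \sum_(m < N) (m`!%:R)^-1 * taylor_part m f a n.
Proof.
move=> sf nN; transitivity (\sum_(m < n.+1) (m`!%:R)^-1 * taylor_part m f a n).
  by apply: eq_bigr => m _; rewrite -(@tuple_partE n.+1).
rewrite (big_ord_widen N (fun m => (m`!%:R)^-1 * taylor_part m f a n)) //.
rewrite big_mkcond; apply: eq_bigr => m _; rewrite ltnS; case: leqP => // nm.
by rewrite taylor_part_small ?mulr0.
Qed.

(** The order-(m+1) part is a symmetric multilinear form evaluated at (u, ..., u). The product rule
    for theta gives m + 1 terms, equal by symmetry of the derivatives. *)
Lemma euler_taylor_part m f a : smooth f ->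
  euler (taylor_part m.+1 f a) =
  (\sum_i euler (coord_series i a) * taylor_part m ('D_(cvec i) f) a) *+ m.+1.
Proof.
elim: m f => [|m IH] f sf.
  rewrite /= euler_sum; apply: eq_bigr => i _.
  by rewrite eulerM euler_const mulr0 addr0 euler_coord_series0.
have {}IH (i : cidx e) := IH _ (smooth_derive (cvec i) sf).
rewrite -[taylor_part m.+2 f a]/(\sum_i coord_series0 i a *
  taylor_part m.+1 ('D_(cvec i) f) a) euler_sum.
under eq_bigr do rewrite eulerM euler_coord_series0 IH.
rewrite big_split /= mulrS; congr (_ + _).
under eq_bigr do rewrite mulrnAr mulr_sumr.
rewrite sumrMnl exchange_big /=; congr (_ *+ _); apply: eq_bigr => j _.
rewrite mulr_sumr; apply: eq_bigr => i _; rewrite mulrCA.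
exact: (congr1 (fun g : V -> R^o => euler (coord_series j a) *
  (coord_series0 i a * taylor_part m g a)) (derive_smooth_swap _ _ sf)).
Qed.

Lemma taylor0 f a : smooth f -> taylor f a 0%N = f (a 0%N).
Proof.
by move=> sf; rewrite (@taylorE 1) // big_ord1 /= fact0 invr1 mul1r.
Qed.

(* Moving the innermost derivative of [taylor] to the front, the Euler operator
   becomes a recursion that characterizes the Taylor expansion. *)
Lemma taylor_euler f a : smooth f ->
  euler (taylor f a) =
  \sum_i euler (coord_series i a) * taylor ('D_(cvec i) f : V -> R^o) a.
Proof.
move=> sf; apply/funext => -[|n].
  by rewrite fps_sum big1 // => i _; rewrite fps_coef0M mul0r.
rewrite -[LHS]/(taylor f a n.+1 *+ n.+1) (@taylorE n.+2) // big_ord_recl /=.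
rewrite mulr0 add0r -sumrMnl fps_sum.
(* Precision h^(n+1) suffices for the partial derivatives, as the factor theta(a_i) supplies one
   more order. *)
have E (i : cidx e) : eqm n.+1 (taylor ('D_(cvec i) f : V -> R^o) a)
  (\sum_(m < n.+1) fps_const (m`!%:R)^-1 * taylor_part m ('D_(cvec i) f) a).
  move=> k kn; rewrite (@taylorE n.+1) //; last exact: smooth_derive.
  by rewrite fps_sum; apply: eq_bigr => m _; rewrite fps_constM.
transitivity (\sum_i (euler (coord_series i a) *
  \sum_(m < n.+1) fps_const (m`!%:R)^-1 * taylor_part m ('D_(cvec i) f) a) n.+1);
  last by apply: eq_bigr => i _; apply/esym/(eqmMS _ (E i)).
under [RHS]eq_bigr do rewrite mulr_sumr fps_sum.
rewrite exchange_big; apply: eq_bigr => m _ /=.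
under [RHS]eq_bigr do rewrite mulrCA fps_constM.
rewrite -mulr_sumr -mulrnAr.
have /(congr1 (@^~ n.+1)) := euler_taylor_part m a sf.
rewrite fpsMn fps_sum => Em.
rewrite -[taylor_part m.+1 f a n.+1 *+ _]/(euler (taylor_part m.+1 f a) n.+1) Em.
(* The factor m + 1 produced by theta turns 1 / (m+1)! into 1 / m!. *)
rewrite -[X in _ * X = _]mulr_natl mulrA factS natrM invfM.
by rewrite [_^-1 * _ * _]mulrAC mulVf ?mul1r // pnatr_eq0.
Qed.

End TaylorRecursion.

Lemma eqmP (T : Type) (a b : fps T) : (forall n, eqm n a b) -> a = b.
Proof. by move=> ab; apply/funext => n; apply: (ab n.+1). Qed.

Lemma eqm_leq (T : Type) m n (a b : fps T) :
  (m <= n)%N -> eqm n a b -> eqm m a b.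
Proof. by move=> mn ab k km; apply: ab; apply: leq_trans mn. Qed.

(** * Algebraic rules for Taylor expansion at a formal point *)

Section TaylorAlgebra.
Context {R : realType} {V : normedModType R} (e : coordinates V).
Implicit Types (f g : V -> R^o) (a : fps V).

Lemma eq_taylor f g a : f =1 g -> taylor f a = taylor g a.
Proof. by move=> /funext ->. Qed.

Lemma derive_smoothD f g v b : smooth f -> smooth g ->
  'D_v (fun x => f x + g x) b = 'D_v f b + 'D_v g b.
Proof.
by move=> sf sg; rewrite deriveD //; apply/diff_derivable/smooth_diff.
Qed.

Lemma derive_smoothM f g v b : smooth f -> smooth g ->
  'D_v (fun x => f x * g x : R^o) b = 'D_v f b * g b + f b * 'D_v g b.
Proof. by move=> sf sg; rewrite derive_mul //; apply: smooth_diff. Qed.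

Lemma derive_smooth_sum I (r : seq I) (P : pred I) (h : I -> V -> R^o) v b :
  (forall i, smooth (h i)) ->
  'D_v (fun x => \sum_(i <- r | P i) h i x) b = \sum_(i <- r | P i) 'D_v (h i) b.
Proof.
move=> sh; elim: r => [|i r IH].
  rewrite big_nil (_ : (fun x => _) = cst 0) ?derive_cst //.
  by apply/funext => x; rewrite big_nil.
rewrite big_cons -IH; case: ifP => Pi.
  rewrite -derive_smoothD //; last exact: smooth_sum.
  by congr (derive _ b v); apply/funext => x; rewrite big_cons Pi.
by congr (derive _ b v); apply/funext => x; rewrite big_cons Pi.
Qed.

(** Both sides satisfy the same recursion. The induction hypothesis covers all smooth pairs, since
    the recursion passes to partial derivatives. *)
Lemma taylorD f g a : smooth f -> smooth g ->
  taylor (fun b => f b + g b) a = taylor f a + taylor g a :> fps R.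
Proof.
move=> sf sg; apply: eqmP => n; elim: n f g sf sg => [//|n IH] f g sf sg.
apply: eqm_euler; first by rewrite fpsD !(taylor0 e) //; apply: smoothD.
rewrite eulerD !(taylor_euler e) //; last exact: smoothD.
rewrite -big_split; apply: eqm_sum => i /=; rewrite -mulrDr.
apply: eqmMS => //; rewrite (eq_taylor a (fun b => derive_smoothD (cvec i) b sf sg)).
by apply: IH; apply: smooth_derive.
Qed.

Lemma taylor_cst (c : R) a : taylor (fun=> c : R^o) a = fps_const c :> fps R.
Proof.
apply: eqmP => n; elim: n c => [//|n IH] c.
apply: eqm_euler; first by rewrite (taylor0 e) //; apply: smooth_cst.
rewrite euler_const (taylor_euler e) //; last exact: smooth_cst.
rewrite [X in eqm _ _ X](_ : _ = \sum_(i : cidx e) euler (coord_series i a) * 0);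
  last by rewrite big1 // => i _; rewrite mulr0.
apply: eqm_sum => i.
apply: eqmMS => //; rewrite (eq_taylor (g := fun=> 0 : R^o) a) => [|b].
  by move=> k kn; rewrite IH //; case: k {kn}.
exact: derive_cst.
Qed.

Lemma taylor_linear (f : {linear V -> R^o}) a : continuous f ->
  taylor f a = (fun n => f (a n)) :> fps R.
Proof.
move=> cf; have sf := smooth_linear cf; apply: eqmP => n.
apply: eqm_euler; first by rewrite (taylor0 e).
rewrite (taylor_euler e) // => k _; rewrite fps_sum.
under eq_bigr => i _.
  rewrite (eq_taylor a (fun b => derive_linear b (cvec i) cf)) taylor_cst.
  rewrite mulrC fps_constM /euler /coord_series mulrnAr.
  over.
rewrite sumrMnl /euler [in RHS](ccoordE e (a k)) linear_sum; congr (_ *+ _).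
by apply: eq_bigr => i _; rewrite linearZ mulrC.
Qed.

Lemma taylor_sum I (r : seq I) (P : pred I) (h : I -> V -> R^o) a :
  (forall i, smooth (h i)) ->
  taylor (fun x => \sum_(i <- r | P i) h i x) a =
  \sum_(i <- r | P i) taylor (h i) a :> fps R.
Proof.
move=> sh; elim: r => [|i r IH].
  rewrite big_nil (eq_taylor (g := fun=> 0 : R^o)) ?taylor_cst => [|x].
    by apply/funext => -[].
  by rewrite big_nil.
rewrite big_cons -IH; case: ifP => Pi.
  rewrite -taylorD //; last exact: smooth_sum.
  by apply: eq_taylor => x; rewrite big_cons Pi.
by apply: eq_taylor => x; rewrite big_cons Pi.
Qed.

Lemma taylorM f g a : smooth f -> smooth g ->
  taylor (fun b => f b * g b : R^o) a = (taylor f a : fps R) * taylor g a.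
Proof.
move=> sf sg; apply: eqmP => n; elim: n f g sf sg => [//|n IH] f g sf sg.
apply: eqm_euler.
  by rewrite fps_coef0M !(taylor0 e) //; apply: smoothM.
rewrite eulerM !(taylor_euler e) //; last exact: smoothM.
rewrite mulr_suml mulr_sumr -big_split; apply: eqm_sum => i /=.
rewrite -mulrA [X in _ + X]mulrCA -mulrDr; apply: eqmMS => //.
rewrite (eq_taylor a (fun b => derive_smoothM (cvec i) b sf sg)).
have sf' := smooth_derive (cvec i) sf; have sg' := smooth_derive (cvec i) sg.
by rewrite taylorD; try exact: smoothM; move=> k kn; rewrite !fpsD !IH.
Qed.

Lemma taylorMl (c : R) f a : smooth f ->
  taylor (fun b => c * f b : R^o) a = fps_const c * (taylor f a : fps R).
Proof.
move=> sf; rewrite taylorM ?taylor_cst //; exact: smooth_cst.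
Qed.

(** In each product of the recursion the argument is first exchanged inside the partial derivative,
    by induction, and then in the factor theta(a_i). *)
Lemma taylor_local n f a b : smooth f ->
  (forall k, (k < n)%N -> a k = b k) -> eqm n (taylor f a : fps R) (taylor f b).
Proof.
elim: n f => [//|n IH] f sf ab; apply: eqm_euler.
  by rewrite !(taylor0 e) // ab.
rewrite !(taylor_euler e) //; apply: eqm_sum => i.
have E : eqm n.+1 (euler (coord_series i a)) (euler (coord_series i b)).
  by move=> k kn; rewrite /euler /coord_series ab.
have T : eqm n.+1
    (euler (coord_series i a) * taylor ('D_(cvec i) f : V -> R^o) a)
    (euler (coord_series i a) * taylor ('D_(cvec i) f : V -> R^o) b).
  apply: eqmMS => //; apply: IH; first exact: smooth_derive.
  by move=> k kn; apply: ab; apply: ltnW.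
by move=> k kn; rewrite T // (eqmM E (fun _ _ => erefl) kn).
Qed.

End TaylorAlgebra.

(** * Formal substitution *)

Section Diagonal.
Context {K : comNzRingType}.
Implicit Types X Y : fps (fps K).

Definition diagonal X : fps K := fun n => \sum_(i < n.+1) X i (n - i)%N.

(** On truncations [diagonal] is evaluation at h of a polynomial over the ring of series;
    multiplicativity is then inherited from polynomial evaluation. *)
Lemma horner_h_coef (p : {poly fps K}) n :
  p.[fps_h] n = \sum_(i < n.+1) p`_i (n - i)%N.
Proof.
have [M sM nM] : exists2 M, (size p <= M)%N & (n < M)%N.
  by exists (size p + n.+1)%N; rewrite ?leq_addr // ltn_addl.
rewrite (horner_coef_wide _ sM) fps_sum.
rewrite [RHS](big_ord_widen M (fun i => p`_i (n - i)%N)) // [RHS]big_mkcond.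
by apply: eq_bigr => i _; rewrite mulrC fps_hXM ltnS.
Qed.

Lemma diagonal_trunc N X n : (n < N)%N -> diagonal X n = (fps_trunc N X).[fps_h] n.
Proof.
move=> nN; rewrite horner_h_coef /diagonal; apply: eq_bigr => i _.
by rewrite coef_poly (leq_trans _ nN).
Qed.

(* [diagonal] substitutes the outer variable by the inner one. *)
Lemma diagonalM X Y : diagonal (X * Y) = diagonal X * diagonal Y.
Proof.
apply/funext => n.
transitivity ((fps_trunc n.+1 X * fps_trunc n.+1 Y).[fps_h] n).
  rewrite horner_h_coef /diagonal; apply: eq_bigr => i _.
  have E : (X * Y) i = (fps_trunc n.+1 X * fps_trunc n.+1 Y)`_i.
    exact: fps_mul_trunc.
  by rewrite E.
rewrite hornerM !fpsM; apply: eq_bigr => i _.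
by rewrite -!diagonal_trunc // ltnS leq_subr.
Qed.

Lemma diagonal_const (c : fps K) : diagonal (fps_const c) = c.
Proof.
apply/funext => n; rewrite /diagonal big_ord_recl /= subn0.
by rewrite big1 ?addr0.
Qed.

Lemma diagonal_sum I (r : seq I) (P : pred I) (F : I -> fps (fps K)) :
  diagonal (\sum_(i <- r | P i) F i) = \sum_(i <- r | P i) diagonal (F i).
Proof.
apply/funext => n; rewrite fps_sum /diagonal exchange_big.
by apply: eq_bigr => i _; rewrite !fps_sum.
Qed.

(** The total degree n is the outer degree i plus the inner degree n - i. *)
Lemma euler_diagonal X :
  euler (diagonal X) = diagonal (euler X) + diagonal (fun i => euler (X i)).
Proof.
apply/funext => n; rewrite fpsD /euler /diagonal -big_split -sumrMnl.
by apply: eq_bigr => i _ /=; rewrite fpsMn -mulrnDr subnKC // -ltnS.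
Qed.

Lemma eqm_diagonal N X Y :
  (forall i, (i < N)%N -> eqm (N - i) (X i) (Y i)) ->
  eqm N (diagonal X) (diagonal Y).
Proof.
move=> XY n nN; rewrite /diagonal; apply: eq_bigr => i _.
have iN : (i < N)%N by apply: leq_ltn_trans nN; rewrite -ltnS.
by rewrite XY // ltn_sub2r.
Qed.

End Diagonal.

Section Families.
Context {R : realType} {U : normedModType R} (eU : coordinates U).
Implicit Types (G H : U -> fps R) (b : fps U).

(* A series with coefficients functions on U is represented by the family of its
   values, a function U -> fps R. *)
Definition smooth_family G := forall n, smooth (fun u => G u n : R^o).

Definition derive_family w G : U -> fps R :=
  fun u n => 'D_w (fun u => G u n : R^o) u.

Lemma smooth_familyM G H : smooth_family G -> smooth_family H ->
  smooth_family (fun u => G u * H u).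
Proof. by move=> sG sH n; apply: smooth_sum => i; apply: smoothM. Qed.

Lemma smooth_familyD G H : smooth_family G -> smooth_family H ->
  smooth_family (fun u => G u + H u).
Proof. by move=> sG sH n; apply: smoothD. Qed.

Lemma smooth_family_sum I (r : seq I) (P : pred I) (G : I -> U -> fps R) :
  (forall i, smooth_family (G i)) ->
  smooth_family (fun u => \sum_(i <- r | P i) G i u).
Proof.
move=> sG n; rewrite (_ : (fun u => _) =
  (fun u => \sum_(i <- r | P i) G i u n)); last first.
  by apply/funext => u; rewrite fps_sum.
by apply: smooth_sum => i; apply: sG.
Qed.

Lemma smooth_family_cst (c : fps R) : smooth_family (fun=> c).
Proof. by move=> n; apply: smooth_cst. Qed.

Lemma smooth_family_euler G : smooth_family G ->
  smooth_family (fun u => euler (G u)).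
Proof.
move=> sG n; rewrite (_ : (fun u => _) = (fun u => n%:R * G u n : R^o)).
  by apply: smoothM => //; apply: smooth_cst.
by apply/funext => u; rewrite mulr_natl.
Qed.

Lemma smooth_family_derive w G : smooth_family G ->
  smooth_family (derive_family w G).
Proof. by move=> sG n; apply: smooth_derive. Qed.

Lemma derive_familyM w G H u : smooth_family G -> smooth_family H ->
  derive_family w (fun u => G u * H u) u =
  derive_family w G u * H u + G u * derive_family w H u.
Proof.
move=> sG sH; apply/funext => n; rewrite fpsD !fpsM -big_split /=.
rewrite -[LHS]/('D_w (fun u => \sum_(i < n.+1) (G u i * H u (n - i)%N : R^o)) u).
rewrite derive_smooth_sum => [|i]; last exact: smoothM.
by apply: eq_bigr => i _; rewrite derive_smoothM.
Qed.

Lemma derive_familyD w G H u : smooth_family G -> smooth_family H ->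
  derive_family w (fun u => G u + H u) u =
  derive_family w G u + derive_family w H u.
Proof. by move=> sG sH; apply/funext => n; apply: derive_smoothD. Qed.

Lemma derive_familyB w G H u : smooth_family G -> smooth_family H ->
  derive_family w (fun u => G u - H u) u =
  derive_family w G u - derive_family w H u.
Proof.
move=> sG sH; apply/funext => n.
by apply: deriveB; apply/diff_derivable/smooth_diff.
Qed.

Lemma derive_family_sum w I (r : seq I) (P : pred I) (G : I -> U -> fps R) u :
  (forall i, smooth_family (G i)) ->
  derive_family w (fun u => \sum_(i <- r | P i) G i u) u =
  \sum_(i <- r | P i) derive_family w (G i) u.
Proof.
move=> sG; apply/funext => n; rewrite fps_sum /derive_family.
rewrite -derive_smooth_sum => [|i]; last exact: sG.
by congr (derive _ u w); apply/funext => v; rewrite fps_sum.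
Qed.

Lemma derive_family_euler w G u : smooth_family G ->
  derive_family w (fun u => euler (G u)) u = euler (derive_family w G u).
Proof.
move=> sG; apply/funext => n; rewrite /derive_family /euler.
rewrite (_ : (fun u => _) = (fun u => n%:R * G u n : R^o)).
  rewrite derive_smoothM //; last exact: smooth_cst.
  by rewrite derive_cst mul0r add0r mulr_natl.
by apply/funext => v; rewrite mulr_natl.
Qed.

Definition family_eval G b : fps R := fps_eval (fun n u => G u n : R^o) b.

Lemma fps_eval_diagonal (F : fps (U -> R^o)) b :
  fps_eval F b = diagonal (fun i => taylor (F i) b : fps R).
Proof. by []. Qed.

Lemma family_eval0 G b : smooth_family G -> family_eval G b 0%N = G (b 0%N) 0%N.
Proof. by move=> sG; rewrite /family_eval /fps_eval big_ord1 (taylor0 eU). Qed.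

Lemma family_evalM G H b : smooth_family G -> smooth_family H ->
  family_eval (fun u => G u * H u) b = family_eval G b * family_eval H b.
Proof.
move=> sG sH; rewrite /family_eval !fps_eval_diagonal -diagonalM.
congr diagonal; apply/funext => n; rewrite fpsM.
rewrite (@taylor_sum _ _ eU _ _ _
  (fun (i : 'I_n.+1) u => G u i * H u (n - i)%N : R^o)) => [|i].
  by apply: eq_bigr => i _; rewrite (taylorM eU).
exact: smoothM.
Qed.

Lemma family_eval_sum I (r : seq I) (P : pred I) (G : I -> U -> fps R) b :
  (forall i, smooth_family (G i)) ->
  family_eval (fun u => \sum_(i <- r | P i) G i u) b =
  \sum_(i <- r | P i) family_eval (G i) b.
Proof.
move=> sG; rewrite /family_eval fps_eval_diagonal.
under [RHS]eq_bigr do rewrite fps_eval_diagonal.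
rewrite -diagonal_sum; congr diagonal; apply/funext => n; rewrite fps_sum.
rewrite -(taylor_sum eU) => [|i]; last exact: sG.
by apply: eq_taylor => u; rewrite fps_sum.
Qed.

Lemma family_eval_cst (c : fps R) b : family_eval (fun=> c) b = c.
Proof.
apply/funext => n; rewrite /family_eval /fps_eval big_ord_recr /=.
rewrite subnn (taylor_cst eU) big1 ?add0r // => i _.
rewrite (taylor_cst eU); case: i => i /= iN.
by case E: (n - i)%N => [|//]; move: iN; rewrite -subn_gt0 E.
Qed.

Lemma eqm_family_eval N G H b : (forall u, eqm N (G u) (H u)) ->
  eqm N (family_eval G b) (family_eval H b).
Proof.
move=> GH; rewrite /family_eval !fps_eval_diagonal; apply: eqm_diagonal => i iN.
by move=> k _; rewrite (eq_taylor b (fun u => GH u i iN)).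
Qed.

(** A total derivative: the first term is the explicit dependence of G on h, the sum is its
    dependence through the point b. *)
Lemma euler_family_eval G b : smooth_family G ->
  euler (family_eval G b) = family_eval (fun u => euler (G u)) b +
    \sum_(j : cidx eU) euler (coord_series j b) *
      family_eval (derive_family (cvec j) G) b.
Proof.
move=> sG; rewrite /family_eval fps_eval_diagonal euler_diagonal.
congr (_ + _).
  rewrite fps_eval_diagonal; congr diagonal; apply/funext => n.
  rewrite /euler -[RHS](_ : taylor (fun u => n%:R * G u n : R^o) b = _).
    rewrite (taylorMl eU) //; apply/funext => k.
    by rewrite fps_constM fpsMn mulr_natl.
  by apply: eq_taylor => u; rewrite mulr_natl.
under eq_bigr do rewrite fps_eval_diagonal -[euler _]diagonal_const -diagonalM.
rewrite -diagonal_sum; congr diagonal; apply/funext => n.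
rewrite (taylor_euler eU) // fps_sum; apply: eq_bigr => j _.
by rewrite fps_constM.
Qed.

End Families.

(** * Chain rule and associativity of substitution *)

Section Composition.
Context {R : realType} {U V : normedModType R}.
Variables (eU : coordinates U) (e : coordinates V).
Implicit Types (f : V -> R^o) (F : fps (V -> R^o)) (A : U -> fps V) (b : fps U).

Definition smooth_arg A :=
  forall i : cidx e, smooth_family (fun u => coord_series i (A u)).

(** The recursion expresses (n+1) times the coefficient of degree n + 1 through coefficients of
    degree at most n of Taylor expansions of partial derivatives, so strong induction on the degree
    applies. *)
Lemma smooth_family_taylor f A : smooth f -> smooth_arg A ->
  smooth_family (fun u => taylor f (A u) : fps R).
Proof.
move=> sf sA n; elim/ltn_ind: n f sf => -[|n] IH f sf.
  rewrite (_ : (fun u => _) = (fun u => f (A u 0%N))).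
    by apply: (smooth_comp (e := e)) => // i; apply: sA.
  by apply/funext => u; rewrite (taylor0 e).
rewrite (_ : (fun u => _) = (fun u => n.+1%:R^-1 *
    \sum_(i : cidx e) \sum_(j < n.+1)
      (euler (coord_series i (A u)) j.+1 *
       taylor ('D_(cvec i) f : V -> R^o) (A u) (n - j)%N) : R^o)).
  apply: smoothM; first exact: smooth_cst.
  apply: smooth_sum => i; apply: smooth_sum => j; apply: smoothM.
    exact: (smooth_family_euler (sA i)).
  by apply: IH; [rewrite ltnS leq_subr | apply: smooth_derive].
apply/funext => u; have /(congr1 (@^~ n.+1)) := taylor_euler e (A u) sf.
rewrite fps_sum {1}/euler => E.
apply: (@mulfI _ n.+1%:R); first by rewrite pnatr_eq0.
rewrite mulrA mulfV ?pnatr_eq0 // mul1r mulr_natl E.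
by apply: eq_bigr => i _; rewrite fpsM big_ord_recl mul0r add0r.
Qed.

(** ['D_w] commutes with theta. Applying theta to both sides gives the same terms with theta falling
    on the derivatives of A; the remaining double sums agree by induction and symmetry of second
    derivatives. *)
Lemma derive_family_taylor w f A u : smooth f -> smooth_arg A ->
  derive_family w (fun u => taylor f (A u) : fps R) u =
  \sum_(i : cidx e) derive_family w (fun u => coord_series i (A u)) u *
    taylor ('D_(cvec i) f : V -> R^o) (A u).
Proof.
move=> sf sA; apply: eqmP => n; elim: n f sf => [//|n IH] f sf.
apply: eqm_euler.
  rewrite fps_sum /derive_family.
  under [RHS]eq_bigr do
    rewrite fps_coef0M (taylor0 e _ (smooth_derive (cvec _) sf)).
  rewrite (_ : (fun u => _) = (fun u => f (A u 0%N))).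
    rewrite (derive_comp_coord (e := e)) //; last exact: smooth_diff.
    by move=> i; apply: smooth_diff; apply: sA.
  by apply/funext => v; rewrite (taylor0 e).
have sfi (i : cidx e) := smooth_derive (cvec i) sf.
have sT (i : cidx e) := smooth_family_taylor (sfi i) sA.
have sE (i : cidx e) := smooth_family_euler (sA i).
rewrite -derive_family_euler; last exact: smooth_family_taylor.
rewrite (_ : (fun u => _) = (fun u => \sum_(i : cidx e)
   euler (coord_series i (A u)) * (taylor ('D_(cvec i) f : V -> R^o) (A u) : fps R)));
  last by apply/funext => v; rewrite (taylor_euler e).
rewrite derive_family_sum => [|i]; last exact: smooth_familyM.
rewrite euler_sum => k kn.
under eq_bigr do rewrite derive_familyM // derive_family_euler //.
under [in RHS]eq_bigr do rewrite eulerM (taylor_euler e) //.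
rewrite !big_split /= !fpsD; congr (_ + _).
under [in RHS]eq_bigr do rewrite mulr_sumr.
rewrite exchange_big /=.
under [in RHS]eq_bigr do under eq_bigr do rewrite mulrCA.
under [in RHS]eq_bigr do rewrite -mulr_sumr.
apply: (eqm_sum (N := n.+1)) kn => i; apply: eqmMS => // {}k kn.
apply: (eq_trans (IH _ (sfi i) k kn)).
apply: (eqm_sum (N := n)) kn => j {}k _.
exact: (congr1 (fun g : V -> R^o =>
  (derive_family w (fun u => coord_series j (A u)) u * (taylor g (A u) : fps R)) k)
  (derive_smooth_swap _ _ sf)).
Qed.

Lemma coord_ext (v w : V) : (forall i : cidx e, ccoord i v = ccoord i w) -> v = w.
Proof.
move=> vw; rewrite (ccoordE e v) (ccoordE e w).
by apply: eq_bigr => i _; rewrite vw.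
Qed.

(** Here a is A evaluated at b, so this is associativity of substitution. After theta is applied,
    both sides are sums over i of theta(a_i) times an instance of the claim for a partial derivative
    of f. *)
Lemma family_eval_taylor f A b (a : fps V) : smooth f -> smooth_arg A ->
  (forall i : cidx e,
    coord_series i a = family_eval (fun u => coord_series i (A u)) b) ->
  family_eval (fun u => taylor f (A u) : fps R) b = taylor f a.
Proof.
move=> sf sA aE; apply: eqmP => n; elim: n f sf => [//|n IH] f sf.
have sT g : smooth g -> smooth_family (fun u => taylor g (A u) : fps R).
  by move=> sg; apply: smooth_family_taylor.
have sfi (i : cidx e) := smooth_derive (cvec i) sf.
have sE (i : cidx e) := smooth_family_euler (sA i).
apply: eqm_euler.
  rewrite (family_eval0 eU) /=; last exact: sT.
  rewrite !(taylor0 e) //; congr f.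
  apply: coord_ext => i; have /(congr1 (@^~ 0%N)) := aE i.
  by rewrite (family_eval0 eU) // => ->.
rewrite (euler_family_eval eU); last exact: sT.
have -> : (fun u => euler (taylor f (A u) : fps R)) = (fun u => \sum_(i : cidx e)
    euler (coord_series i (A u)) * (taylor ('D_(cvec i) f : V -> R^o) (A u) : fps R)).
  by apply/funext => u; rewrite (taylor_euler e).
have dT w : derive_family w (fun u => taylor f (A u) : fps R) =
    (fun u => \sum_(i : cidx e)
      derive_family w (fun u => coord_series i (A u)) u *
      (taylor ('D_(cvec i) f : V -> R^o) (A u) : fps R)).
  by apply/funext => u; apply: derive_family_taylor.
rewrite (family_eval_sum eU) => [|i]; last exact: smooth_familyM (sE i) (sT _ (sfi i)).
have EM (i : cidx e) := family_evalM eU b (sE i) (sT _ (sfi i)).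
have DM w (i : cidx e) :=
  family_evalM eU b (smooth_family_derive w (sA i)) (sT _ (sfi i)).
move=> k kn; under eq_bigr do rewrite EM.
under [X in (_ + X) _]eq_bigr => j _.
  rewrite dT (family_eval_sum eU) => [|i]; last first.
    exact: smooth_familyM (smooth_family_derive _ (sA i)) (sT _ (sfi i)).
  rewrite mulr_sumr.
  under eq_bigr do rewrite DM mulrA.
  over.
rewrite exchange_big -big_split /= (taylor_euler e) //.
apply: (eqm_sum (N := n.+1)) kn => i; rewrite -mulr_suml.
rewrite -[X in eqm _ X _](mulrDl (family_eval _ b)) -(euler_family_eval eU) // -aE.
by apply: eqmMS => //; apply: IH.
Qed.

(** Modulo h^N evaluation is a finite sum of the h^i F_i(a), to which the rules for finite sums and
    products apply. *)
Lemma fps_eval_trunc N F (a : fps V) :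
  eqm N (fps_eval F a) (\sum_(i < N) fps_h ^+ i * (taylor (F i) a : fps R)).
Proof.
move=> n nN; rewrite fps_sum /fps_eval.
rewrite (big_ord_widen N (fun i => taylor (F i) a (n - i)%N)) // big_mkcond.
by apply: eq_bigr => i _; rewrite fps_hXM ltnS.
Qed.

Lemma smooth_family_fps_eval F A : (forall n, smooth (F n)) -> smooth_arg A ->
  smooth_family (fun u => fps_eval F (A u) : fps R).
Proof.
by move=> sF sA n; apply: smooth_sum => i; apply: smooth_family_taylor.
Qed.

Lemma derive_family_fps_eval w F A u :
  (forall n, smooth (F n)) -> smooth_arg A ->
  derive_family w (fun u => fps_eval F (A u) : fps R) u =
  \sum_(i : cidx e) derive_family w (fun u => coord_series i (A u)) u *
    fps_eval (fun n => 'D_(cvec i) (F n) : V -> R^o) (A u).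
Proof.
move=> sF sA; apply/funext => n; rewrite fps_sum.
have sT i := smooth_family_taylor (sF i) sA.
rewrite [LHS]/derive_family.
transitivity (\sum_(i < n.+1)
   derive_family w (fun u => taylor (F i) (A u) : fps R) u (n - i)%N).
  by rewrite -derive_smooth_sum // => i; apply: sT.
under eq_bigr do rewrite derive_family_taylor // fps_sum.
rewrite exchange_big; apply: eq_bigr => i _ /=.
rewrite fps_eval_diagonal.
set c := derive_family w _ u; rewrite -[in RHS](diagonal_const c) -diagonalM.
by apply: eq_bigr => j _; rewrite fps_constM.
Qed.

Lemma family_eval_fps_eval F A b (a : fps V) :
  (forall n, smooth (F n)) -> smooth_arg A ->
  (forall i : cidx e,
    coord_series i a = family_eval (fun u => coord_series i (A u)) b) ->
  family_eval (fun u => fps_eval F (A u) : fps R) b = fps_eval F a.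
Proof.
move=> sF sA aE; apply: eqmP => N n nN.
have sT i := smooth_family_taylor (sF i) sA.
have /(_ n nN) -> : eqm N (family_eval (fun u => fps_eval F (A u) : fps R) b)
    (family_eval (fun u =>
      \sum_(i < N) fps_h ^+ i * (taylor (F i) (A u) : fps R)) b).
  by apply: eqm_family_eval => u; apply: fps_eval_trunc.
rewrite (family_eval_sum eU) => [|i]; last first.
  by apply: smooth_familyM; [apply: smooth_family_cst|apply: sT].
rewrite (fps_eval_trunc F a nN) !fps_sum; apply: eq_bigr => i _.
rewrite (family_evalM eU) //; last exact: smooth_family_cst.
by rewrite (family_eval_cst eU) (family_eval_taylor (sF i) sA aE).
Qed.

End Composition.

(** * Generating functions *)

Section CoordinateSystems.
Context {R : realType}.

Definition entry m n (i : 'I_m) (j : 'I_n) (M : 'M[R]_(m, n)) : R^o := M i j.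

Lemma entry_is_linear m n (i : 'I_m) (j : 'I_n) : linear (entry i j).
Proof. by move=> c M N; rewrite /entry !mxE. Qed.

HB.instance Definition _ m n (i : 'I_m) (j : 'I_n) :=
  GRing.isLinear.Build R 'M[R]_(m, n) R^o *:%R (entry i j) (entry_is_linear i j).

Lemma entry_continuous m n (i : 'I_m) (j : 'I_n) : continuous (entry i j).
Proof. exact: coord_continuous. Qed.

Definition row_coordinates n : coordinates 'rV[R]_n.
Proof.
apply: (@Coordinates R 'rV[R]_n 'I_n (fun i => delta_mx 0 i)
  (fun i => entry 0 i)) => [i|v]; first exact: entry_continuous.
exact: row_sum_delta.
Defined.

Definition col_coordinates n : coordinates 'cV[R]_n.
Proof.
apply: (@Coordinates R 'cV[R]_n 'I_n (fun i => delta_mx i 0)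
  (fun i => entry i 0)) => [i|v]; first exact: entry_continuous.
rewrite {1}(matrix_sum_delta v); apply: eq_bigr => i _.
by rewrite big_ord1.
Defined.

Definition pair_coordinates (V W : normedModType R) (eV : coordinates V)
  (eW : coordinates W) : coordinates (V * W)%type.
Proof.
apply: (@Coordinates R (V * W)%type (cidx eV + cidx eW)%type
  (fun i => match i with inl i => (cvec i, 0) | inr i => (0, cvec i) end)
  (fun i => match i with inl i => (ccoord i \o fst) | inr i => (ccoord i \o snd) end)).
- case=> i v; apply: continuous_comp => //=; try exact: ccoord_continuous.
    exact: cvg_fst.
  exact: cvg_snd.
move=> [v w]; rewrite big_sumType /= {1}(ccoordE eV v) {1}(ccoordE eW w).
have -> : \sum_(i : cidx eV) ccoord i v *: ((cvec i, 0) : V * W) =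
    (\sum_(i : cidx eV) ccoord i v *: cvec i, 0).
  elim/big_rec2: _ => // i y z _ ->.
  by congr pair; rewrite /= scaler0 add0r.
have -> : \sum_(i : cidx eW) ccoord i w *: ((0, cvec i) : V * W) =
    (0, \sum_(i : cidx eW) ccoord i w *: cvec i).
  elim/big_rec2: _ => // i y z _ ->.
  by congr pair; rewrite /= scaler0 add0r.
by congr pair; rewrite ?addr0 ?add0r.
Defined.

(** [inl (inl k)], [inl (inr k)] and [inr k] index the k-th coordinates of p1, p2 and x. *)
Definition B2_coordinates d : coordinates (B2 R d) :=
  pair_coordinates (pair_coordinates (row_coordinates d) (row_coordinates d))
    (col_coordinates d).

Definition B3 d : normedModType R :=
  ('rV[R]_d * 'rV[R]_d * 'rV[R]_d * 'cV[R]_d)%type.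

Definition B3_coordinates d : coordinates (B3 d) :=
  pair_coordinates (pair_coordinates
    (pair_coordinates (row_coordinates d) (row_coordinates d))
    (row_coordinates d)) (col_coordinates d).

End CoordinateSystems.

(** * Reduction of vector-valued series to scalar entries *)

Section MatrixValued.
Context {R : realType} {V : normedModType R} {m n : nat}.
Implicit Type f : V -> 'M[R]_(m, n).

Lemma dderivs_entry vs f b i j :
  (forall i j, smooth (fun b => f b i j : R^o)) ->
  dderivs vs f b i j = dderivs vs (fun b => f b i j : R^o) b.
Proof.
move=> sf; elim: vs b i j => [//|v vs IH] b i j.
rewrite -[LHS]/('D_v (dderivs vs f) b i j) derive_mx ?mxE.
  by congr (derive _ b v); apply/funext => c; apply: IH.
apply/derivable_mxP => k l; rewrite (_ : (fun x => _) =
  dderivs vs (fun b => f b k l : R^o)); last by apply/funext => c; apply: IH.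
exact/diff_derivable/(sf k l).
Qed.

Lemma taylor_entry f (a : fps V) k i j :
  (forall i j, smooth (fun b => f b i j : R^o)) ->
  taylor f a k i j = taylor (fun b => f b i j : R^o) a k.
Proof.
move=> sf; rewrite /taylor summxE; apply: eq_bigr => l _.
rewrite mxE summxE; congr (_ * _); apply: eq_bigr => t _.
exact: dderivs_entry.
Qed.

Lemma fps_eval_entry (F : fps (V -> 'M[R]_(m, n))) (a : fps V) k i j :
  (forall l i j, smooth (fun b => F l b i j : R^o)) ->
  fps_eval F a k i j = fps_eval (fun l b => F l b i j : R^o) a k.
Proof.
move=> sF; rewrite /fps_eval summxE; apply: eq_bigr => l _.
exact: taylor_entry.
Qed.

End MatrixValued.

Section MatrixFamilies.
Context {R : realType}.

Definition entry_series m n (M : fps 'M[R]_(m, n)) i j : fps R :=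
  fun k => M k i j.

Lemma entry_series_ext m n (M N : fps 'M[R]_(m, n)) :
  (forall i j, entry_series M i j = entry_series N i j) -> M = N.
Proof.
move=> MN; apply/funext => k; apply/matrixP => i j.
exact: (congr1 (@^~ k) (MN i j)).
Qed.

Context {U : normedModType R} (eU : coordinates U) (m n : nat).
Implicit Types (P : U -> fps 'M[R]_(m, n)) (b : fps U).

Definition smooth_mx P :=
  forall i j, smooth_family (fun u => entry_series (P u) i j).

Definition subst_mx P b : fps 'M[R]_(m, n) :=
  fun k => \matrix_(i, j) family_eval (fun u => entry_series (P u) i j) b k.

Lemma entry_series_subst P b i j :
  entry_series (subst_mx P b) i j = family_eval (fun u => entry_series (P u) i j) b.
Proof. by apply/funext => k; rewrite /entry_series mxE. Qed.

Variable L : {linear U -> 'M[R]_(m, n)}.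
Hypothesis cL : continuous L.

Let entryL i j : {linear U -> R^o} := (entry i j \o L).

Let entryL_continuous i j : continuous (entryL i j).
Proof.
by move=> u; apply: continuous_comp; [exact: cL | exact: entry_continuous].
Qed.

Let entry_const u i j :
  entry_series (fps_const (L u)) i j = fps_const (entryL i j u).
Proof. by apply/funext => -[|k]; rewrite /entry_series //= mxE. Qed.

Lemma smooth_mx_linear : smooth_mx (fun u => fps_const (L u)).
Proof.
move=> i j k; rewrite (_ : (fun u => _) = fun u => fps_const (entryL i j u) k).
  case: k => [|k]; last exact: smooth_cst.
  exact: (smooth_linear (@entryL_continuous i j)).
by apply/funext => u; rewrite entry_const.
Qed.

(** A projection regarded as a family constant in h turns into an arbitrary formal series under
    substitution. This is the passage from constant to formal arguments. *)
Lemma subst_mx_linear b : subst_mx (fun u => fps_const (L u)) b = fun k => L (b k).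
Proof.
apply/funext => k; apply/matrixP => i j; rewrite mxE.
rewrite (_ : (fun u => _) = fun u => fps_const (entryL i j u)); last first.
  by apply/funext => u; rewrite entry_const.
rewrite /family_eval /fps_eval big_ord_recl /= subn0 big1 ?addr0 => [|l _].
  exact: (congr1 (@^~ k) (taylor_linear eU b (@entryL_continuous i j))).
by rewrite (taylor_cst eU); case: (k - _)%N.
Qed.

Lemma derive_family_linear w u i j :
  derive_family w (fun u => entry_series (fps_const (L u)) i j) u =
  fps_const (L w i j : R).
Proof.
apply/funext => k; rewrite /derive_family.
rewrite (_ : (fun u => _) = fun u => fps_const (entryL i j u) k); last first.
  by apply/funext => v; rewrite entry_const.
case: k => [|k]; last exact: derive_cst.
exact: derive_linear (@entryL_continuous i j).
Qed.

End MatrixFamilies.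

(** * Values and gradients of S along families *)

Section GeneratingFamilies.
Context {R : realType} {d : nat}.
Variable S : fps (B2 R d -> R^o).
Hypothesis sS : forall n, smooth (S n).

Local Notation e2 := (B2_coordinates d).

Definition dS_p1 (k : 'I_d) : fps (B2 R d -> R^o) :=
  fun n => 'D_((delta_mx 0 k, 0, 0) : B2 R d) (S n).
Definition dS_p2 (k : 'I_d) : fps (B2 R d -> R^o) :=
  fun n => 'D_((0, delta_mx 0 k, 0) : B2 R d) (S n).
Definition dS_x (k : 'I_d) : fps (B2 R d -> R^o) :=
  fun n => 'D_((0, 0, delta_mx k 0) : B2 R d) (S n).

Lemma smooth_dS_p1 k n : smooth (dS_p1 k n).
Proof. exact: smooth_derive. Qed.
Lemma smooth_dS_p2 k n : smooth (dS_p2 k n).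
Proof. exact: smooth_derive. Qed.
Lemma smooth_dS_x k n : smooth (dS_x k n).
Proof. exact: smooth_derive. Qed.

Lemma Sgrad_p1_series p1 p2 x k j :
  entry_series (Sgrad_p1 S p1 p2 x) k j = fps_eval (dS_p1 k) (fps_B2 p1 p2 x).
Proof.
have E (l : nat) i j' : (fun b => grad_p1 (S l) b i j' : R^o) = dS_p1 i l.
  by apply/funext => b; rewrite mxE.
apply/funext => n; rewrite /entry_series /Sgrad_p1 fps_eval_entry => [|l i j'].
  by congr fps_eval; apply/funext => l; rewrite E.
by rewrite E; apply: smooth_dS_p1.
Qed.

Lemma Sgrad_p2_series p1 p2 x k j :
  entry_series (Sgrad_p2 S p1 p2 x) k j = fps_eval (dS_p2 k) (fps_B2 p1 p2 x).
Proof.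
have E (l : nat) i j' : (fun b => grad_p2 (S l) b i j' : R^o) = dS_p2 i l.
  by apply/funext => b; rewrite mxE.
apply/funext => n; rewrite /entry_series /Sgrad_p2 fps_eval_entry => [|l i j'].
  by congr fps_eval; apply/funext => l; rewrite E.
by rewrite E; apply: smooth_dS_p2.
Qed.

Lemma Sgrad_x_series p1 p2 x j k :
  entry_series (Sgrad_x S p1 p2 x) j k = fps_eval (dS_x k) (fps_B2 p1 p2 x).
Proof.
have E (l : nat) i j' : (fun b => grad_x (S l) b i j' : R^o) = dS_x j' l.
  by apply/funext => b; rewrite mxE.
apply/funext => n; rewrite /entry_series /Sgrad_x fps_eval_entry => [|l i j'].
  by congr fps_eval; apply/funext => l; rewrite E.
by rewrite E; apply: smooth_dS_x.
Qed.

Lemma fps_pairing_series (p : fps 'rV[R]_d) (x : fps 'cV[R]_d) :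
  fps_pairing p x = \sum_k entry_series p 0 k * entry_series x k 0 :> fps R.
Proof.
apply/funext => n; rewrite fps_sum.
under [RHS]eq_bigr do rewrite fpsM.
rewrite exchange_big; apply: eq_bigr => i _; rewrite /pairing mxE.
by apply: eq_bigr => j _.
Qed.

Context {U : normedModType R} (eU : coordinates U).
Variables (P1 P2 : U -> fps 'rV[R]_d) (X : U -> fps 'cV[R]_d).
Hypotheses (sP1 : smooth_mx P1) (sP2 : smooth_mx P2) (sX : smooth_mx X).

Lemma smooth_arg_B2 : smooth_arg e2 (fun u => fps_B2 (P1 u) (P2 u) (X u)).
Proof. by case=> [[k|k]|k]; [apply: sP1 | apply: sP2 | apply: sX]. Qed.

Lemma smooth_mx_Sgrad_p1 : smooth_mx (fun u => Sgrad_p1 S (P1 u) (P2 u) (X u)).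
Proof.
move=> k j; rewrite (funext (fun u => Sgrad_p1_series _ _ _ k j)).
exact: smooth_family_fps_eval (smooth_dS_p1 k) smooth_arg_B2.
Qed.

Lemma smooth_mx_Sgrad_p2 : smooth_mx (fun u => Sgrad_p2 S (P1 u) (P2 u) (X u)).
Proof.
move=> k j; rewrite (funext (fun u => Sgrad_p2_series _ _ _ k j)).
exact: smooth_family_fps_eval (smooth_dS_p2 k) smooth_arg_B2.
Qed.

Lemma smooth_mx_Sgrad_x : smooth_mx (fun u => Sgrad_x S (P1 u) (P2 u) (X u)).
Proof.
move=> j k; rewrite (funext (fun u => Sgrad_x_series _ _ _ j k)).
exact: smooth_family_fps_eval (smooth_dS_x k) smooth_arg_B2.
Qed.

Lemma smooth_family_Sval : smooth_family (fun u => Sval S (P1 u) (P2 u) (X u)).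
Proof. exact: smooth_family_fps_eval sS smooth_arg_B2. Qed.

Lemma smooth_family_pairing : smooth_family (fun u => fps_pairing (P1 u) (X u)).
Proof.
rewrite (funext (fun u => fps_pairing_series (P1 u) (X u))).
by apply: smooth_family_sum => k; apply: smooth_familyM; [apply: sP1|apply: sX].
Qed.

Lemma derive_family_Sval w u :
  derive_family w (fun u => Sval S (P1 u) (P2 u) (X u)) u =
  \sum_k (
    derive_family w (fun u => entry_series (P1 u) 0 k) u *
      entry_series (Sgrad_p1 S (P1 u) (P2 u) (X u)) k 0 +
    derive_family w (fun u => entry_series (P2 u) 0 k) u *
      entry_series (Sgrad_p2 S (P1 u) (P2 u) (X u)) k 0 +
    derive_family w (fun u => entry_series (X u) k 0) u *
      entry_series (Sgrad_x S (P1 u) (P2 u) (X u)) 0 k).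
Proof.
rewrite (derive_family_fps_eval w u sS smooth_arg_B2) !big_sumType /=.
rewrite -!big_split; apply: eq_bigr => k _ /=.
congr (_ + _ + _); congr (_ * _); symmetry.
- exact: Sgrad_p1_series.
- exact: Sgrad_p2_series.
- exact: Sgrad_x_series.
Qed.

Lemma derive_family_pairing w u :
  derive_family w (fun u => fps_pairing (P1 u) (X u)) u =
  \sum_k (
    derive_family w (fun u => entry_series (P1 u) 0 k) u * entry_series (X u) k 0 +
    entry_series (P1 u) 0 k * derive_family w (fun u => entry_series (X u) k 0) u).
Proof.
rewrite (funext (fun u => fps_pairing_series (P1 u) (X u))).
rewrite derive_family_sum => [|k].
  by apply: eq_bigr => k _; apply: derive_familyM.
exact: smooth_familyM.
Qed.

Lemma coord_series_subst b (i : cidx e2) :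
  coord_series i (fps_B2 (subst_mx P1 b) (subst_mx P2 b) (subst_mx X b)) =
  family_eval (fun u => coord_series i (fps_B2 (P1 u) (P2 u) (X u))) b.
Proof. by case: i => [[k|k]|k]; apply: entry_series_subst. Qed.

(** Associativity of substitution, entry by entry. With its two companions it carries gradient
    identities from constant to formal arguments. *)
Lemma subst_Sgrad_p1 b :
  subst_mx (fun u => Sgrad_p1 S (P1 u) (P2 u) (X u)) b =
  Sgrad_p1 S (subst_mx P1 b) (subst_mx P2 b) (subst_mx X b).
Proof.
apply: entry_series_ext => k j; rewrite entry_series_subst Sgrad_p1_series.
rewrite (funext (fun u => Sgrad_p1_series _ _ _ k j)).
exact: (family_eval_fps_eval eU (smooth_dS_p1 k) smooth_arg_B2 (coord_series_subst b)).
Qed.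

Lemma subst_Sgrad_p2 b :
  subst_mx (fun u => Sgrad_p2 S (P1 u) (P2 u) (X u)) b =
  Sgrad_p2 S (subst_mx P1 b) (subst_mx P2 b) (subst_mx X b).
Proof.
apply: entry_series_ext => k j; rewrite entry_series_subst Sgrad_p2_series.
rewrite (funext (fun u => Sgrad_p2_series _ _ _ k j)).
exact: (family_eval_fps_eval eU (smooth_dS_p2 k) smooth_arg_B2 (coord_series_subst b)).
Qed.

Lemma subst_Sgrad_x b :
  subst_mx (fun u => Sgrad_x S (P1 u) (P2 u) (X u)) b =
  Sgrad_x S (subst_mx P1 b) (subst_mx P2 b) (subst_mx X b).
Proof.
apply: entry_series_ext => j k; rewrite entry_series_subst Sgrad_x_series.
rewrite (funext (fun u => Sgrad_x_series _ _ _ j k)).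
exact: (family_eval_fps_eval eU (smooth_dS_x k) smooth_arg_B2 (coord_series_subst b)).
Qed.

End GeneratingFamilies.

(** * Fixed points of h-adic contractions *)

Section Contraction.
Context {T : Type}.
Implicit Types (a b : fps T) (f : fps T -> fps T).

Definition fps_contraction f :=
  forall N a b, eqm N a b -> eqm N.+1 (f a) (f b).

(** The iterates of a contraction stabilise coefficientwise: the coefficient of h^n no longer
    changes after n + 1 steps, whatever the starting value t. *)
Definition fps_fix f (t : T) : fps T := fun n => iter n.+1 f (fun=> t) n.

Lemma fps_fixE f t : fps_contraction f -> f (fps_fix f t) = fps_fix f t.
Proof.
move=> cf; pose it n : fps T := iter n f (fun=> t).
have E n m : (n <= m)%N -> eqm n (it n) (it m).
  elim: n m => [//|n IH] [//|m]; rewrite ltnS => nm.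
  by apply: (cf n (it n) (it m)); apply: IH.
apply/funext => n; apply: (cf n (fps_fix f t) (it n)) => // k kn.
exact: (E k.+1 n kn).
Qed.

Lemma fps_contraction_unique f a b : fps_contraction f -> f a = a -> f b = b -> a = b.
Proof.
move=> cf fa fb; apply: eqmP => n; elim: n => [//|n IH].
by rewrite -fa -fb; apply: cf.
Qed.

End Contraction.

(** Every coefficient of the fixed point is a coefficient of a finite iterate starting from 0, and
    each step preserves smoothness in the parameter u. *)
Lemma smooth_fixpoint (R : realType) (U : normedModType R) d
    (F : U -> fps 'rV[R]_d -> fps 'cV[R]_d) (G : U -> fps 'cV[R]_d -> fps 'rV[R]_d) :
  (forall u N p q, eqm N p q -> eqm N.+1 (F u p) (F u q)) ->
  (forall u N x y, eqm N x y -> eqm N.+1 (G u x) (G u y)) ->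
  (forall P, smooth_mx P -> smooth_mx (fun u => F u (P u))) ->
  (forall X, smooth_mx X -> smooth_mx (fun u => G u (X u))) ->
  exists X P, [/\ smooth_mx X, smooth_mx P,
    forall u, X u = F u (P u) & forall u, P u = G u (X u)].
Proof.
move=> cF cG sF sG; pose f u x := F u (G u x).
have cf u : fps_contraction (f u).
  (* F and G each gain an order; one of the two is discarded. *)
  by move=> N a b ab; apply: (eqm_leq (leqnSn _)); apply/cF/cG.
pose X u := fps_fix (f u) 0.
have sX : smooth_mx X.
  move=> i j n.
  suff : smooth_mx (fun u => iter n.+1 (f u) (fun=> 0)) by move/(_ i j n).
  elim: n.+1 => [|k IH] /=; last by apply: sF; apply: sG.
  by move=> k l q; apply: smooth_cst.
exists X, (fun u => G u (X u)); split=> // [|u]; first exact: sG.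
exact/esym/(fps_fixE 0 (cf u)).
Qed.

(** Once F_0 is removed, every remaining term carries a factor h, so knowing the argument modulo h^N
    determines the rest modulo h^(N+1). *)
Lemma fps_eval_local (R : realType) (V : normedModType R) (e : coordinates V)
    N (F : fps (V -> R^o)) (a b : fps V) :
  (forall n, smooth (F n)) -> eqm N a b ->
  eqm N.+1 (fun n => fps_eval F a n - taylor (F 0%N) a n : R)
    (fun n => fps_eval F b n - taylor (F 0%N) b n).
Proof.
move=> sF ab n nN; rewrite /fps_eval !big_ord_recl !subn0.
rewrite ![taylor (F (nat_of_ord ord0)) _ _ + _]addrC !addrK.
apply: eq_bigr => i _; apply: (taylor_local e (sF _) ab).
rewrite lift0 /=; case: n nN i => [_ []//|n nN i].
by rewrite subSS (leq_ltn_trans (leq_subr _ _)).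
Qed.

(** * The auxiliary series of the SGA equation *)

Section Legendre.
Context {R : realType} {d : nat}.
Variable S : fps (B2 R d -> R^o).
Hypothesis sS : forall n, smooth (S n).
Hypothesis S0E : forall (p1 p2 : 'rV[R]_d) (x : 'cV[R]_d),
  S 0%N (p1, p2, x) = pairing (p1 + p2) x.

Local Notation e2 := (B2_coordinates d).

Let c1 (k : 'I_d) : {linear B2 R d -> R^o} := ccoord (inl (inl k) : cidx e2).
Let c2 (k : 'I_d) : {linear B2 R d -> R^o} := ccoord (inl (inr k) : cidx e2).
Let cx (k : 'I_d) : {linear B2 R d -> R^o} := ccoord (inr k : cidx e2).

Lemma S0_coord : S 0%N = fun b => \sum_k ((c1 k b + c2 k b) * cx k b : R^o).
Proof.
apply/funext => -[[p1 p2] x]; rewrite S0E /pairing mxE.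
by apply: eq_bigr => k _; rewrite mxE.
Qed.

Lemma derive_S0 w b : 'D_w (S 0%N) b =
  \sum_k ((c1 k w + c2 k w) * cx k b + (c1 k b + c2 k b) * cx k w).
Proof.
have sc (i : cidx e2) : smooth (ccoord i : B2 R d -> R^o) by apply: smooth_coord.
have cc (i : cidx e2) := @ccoord_continuous _ _ e2 i.
have s12 k : smooth (fun b => c1 k b + c2 k b : R^o).
  by apply: smoothD; apply: sc.
rewrite S0_coord derive_smooth_sum => [|k]; last first.
  by apply: smoothM; [apply: s12 | apply: sc].
apply: eq_bigr => k _; rewrite derive_smoothM //; last exact: sc.
rewrite derive_smoothD; try exact: sc.
by rewrite !derive_linear //; apply: cc.
Qed.

Lemma dS_p1_0 k : dS_p1 S k 0%N = cx k.
Proof.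
apply/funext => b; rewrite [LHS]derive_S0 (bigD1 k) //= big1 => [|j jk].
  by rewrite /entry !mxE !eqxx mulr0 !addr0 mul1r.
by rewrite /entry !mxE (negbTE jk) andbF mulr0 !addr0 mul0r.
Qed.

Lemma dS_p2_0 k : dS_p2 S k 0%N = cx k.
Proof.
apply/funext => b; rewrite [LHS]derive_S0 (bigD1 k) //= big1 => [|j jk].
  by rewrite /entry !mxE !eqxx mulr0 !addr0 add0r mul1r.
by rewrite /entry !mxE (negbTE jk) andbF mulr0 !addr0 mul0r.
Qed.

Lemma dS_x_0 k : dS_x S k 0%N = fun b => c1 k b + c2 k b.
Proof.
apply/funext => b; rewrite [LHS]derive_S0 (bigD1 k) //= big1 => [|j jk].
  by rewrite /entry !mxE !eqxx !addr0 mul0r add0r mulr1.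
by rewrite /entry !mxE (negbTE jk) mulr0 !addr0 mul0r.
Qed.

Lemma taylor_dS_p1_0 k p1 p2 x :
  taylor (dS_p1 S k 0%N) (fps_B2 p1 p2 x) = entry_series x k 0.
Proof. by rewrite dS_p1_0 (taylor_linear e2) //; apply: ccoord_continuous. Qed.

Lemma taylor_dS_p2_0 k p1 p2 x :
  taylor (dS_p2 S k 0%N) (fps_B2 p1 p2 x) = entry_series x k 0.
Proof. by rewrite dS_p2_0 (taylor_linear e2) //; apply: ccoord_continuous. Qed.

Lemma taylor_dS_x_0 k p1 p2 x :
  taylor (dS_x S k 0%N) (fps_B2 p1 p2 x) =
  entry_series p1 0 k + entry_series p2 0 k.
Proof.
rewrite dS_x_0 (taylorD e2); try exact: (smooth_coord (e := e2)).
by rewrite !(taylor_linear e2) //; apply: ccoord_continuous.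
Qed.

Section Local.
Variables (N : nat) (p1 p2 q1 q2 : fps 'rV[R]_d) (x y : fps 'cV[R]_d).
Hypotheses (pq1 : eqm N p1 q1) (pq2 : eqm N p2 q2) (xy : eqm N x y).

Let ab : eqm N (fps_B2 p1 p2 x) (fps_B2 q1 q2 y).
Proof. by move=> n nN; rewrite /fps_B2 pq1 // pq2 // xy. Qed.

Lemma Sgrad_p1_local : eqm N.+1 (fun n => Sgrad_p1 S p1 p2 x n - x n)
  (fun n => Sgrad_p1 S q1 q2 y n - y n).
Proof.
move=> n nN; apply/matrixP => k j; rewrite !mxE !ord1.
have := fps_eval_local e2 (smooth_dS_p1 sS k) ab nN.
by rewrite -!(Sgrad_p1_series sS _ _ _ _ 0) !taylor_dS_p1_0.
Qed.

Lemma Sgrad_p2_local : eqm N.+1 (fun n => Sgrad_p2 S p1 p2 x n - x n)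
  (fun n => Sgrad_p2 S q1 q2 y n - y n).
Proof.
move=> n nN; apply/matrixP => k j; rewrite !mxE !ord1.
have := fps_eval_local e2 (smooth_dS_p2 sS k) ab nN.
by rewrite -!(Sgrad_p2_series sS _ _ _ _ 0) !taylor_dS_p2_0.
Qed.

Lemma Sgrad_x_local : eqm N.+1 (fun n => Sgrad_x S p1 p2 x n - (p1 n + p2 n))
  (fun n => Sgrad_x S q1 q2 y n - (q1 n + q2 n)).
Proof.
move=> n nN; apply/matrixP => j k; rewrite !mxE !ord1.
have := fps_eval_local e2 (smooth_dS_x sS k) ab nN.
by rewrite -!(Sgrad_x_series sS _ _ _ 0) !taylor_dS_x_0.
Qed.

End Local.

(** The leading part of this gradient is x, which is held fixed; p enters only through the terms of
    S with a factor h. *)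
Lemma Sgrad_p1_contraction p2 x N p q : eqm N p q ->
  eqm N.+1 (Sgrad_p1 S p p2 x) (Sgrad_p1 S q p2 x).
Proof.
move=> pq n nN.
exact: (addIr _ (Sgrad_p1_local pq (fun _ _ => erefl) (fun _ _ => erefl) nN)).
Qed.

Lemma Sgrad_p2_contraction p1 x N p q : eqm N p q ->
  eqm N.+1 (Sgrad_p2 S p1 p x) (Sgrad_p2 S p1 q x).
Proof.
move=> pq n nN.
exact: (addIr _ (Sgrad_p2_local (fun _ _ => erefl) pq (fun _ _ => erefl) nN)).
Qed.

Lemma Sgrad_x_contraction p1 p2 N x y : eqm N x y ->
  eqm N.+1 (Sgrad_x S p1 p2 x) (Sgrad_x S p1 p2 y).
Proof.
move=> xy n nN.
exact: (addIr _ (Sgrad_x_local (fun _ _ => erefl) (fun _ _ => erefl) xy nN)).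
Qed.

(** Eliminating [pb] leaves a fixed-point equation for [xb] whose right-hand side is a
    contraction. *)
Lemma bar_unique p1 p2 p3 x xb pb xb' pb' :
  xb = Sgrad_p1 S pb p3 x -> pb = Sgrad_x S p1 p2 xb ->
  xb' = Sgrad_p1 S pb' p3 x -> pb' = Sgrad_x S p1 p2 xb' ->
  xb = xb' /\ pb = pb'.
Proof.
move=> ex ep ex' ep'; suff E : xb = xb' by rewrite ep ep' E.
apply: (fps_contraction_unique (f := fun y => Sgrad_p1 S (Sgrad_x S p1 p2 y) p3 x)).
- move=> N a b ab; apply: (eqm_leq (leqnSn _)).
  exact/Sgrad_p1_contraction/Sgrad_x_contraction.
- by rewrite -ep -ex.
- by rewrite -ep' -ex'.
Qed.

Lemma tilde_unique p1 p2 p3 x xt pt xt' pt' :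
  xt = Sgrad_p2 S p1 pt x -> pt = Sgrad_x S p2 p3 xt ->
  xt' = Sgrad_p2 S p1 pt' x -> pt' = Sgrad_x S p2 p3 xt' ->
  xt = xt' /\ pt = pt'.
Proof.
move=> ex ep ex' ep'; suff E : xt = xt' by rewrite ep ep' E.
apply: (fps_contraction_unique (f := fun y => Sgrad_p2 S p1 (Sgrad_x S p2 p3 y) x)).
- move=> N a b ab; apply: (eqm_leq (leqnSn _)).
  exact/Sgrad_p2_contraction/Sgrad_x_contraction.
- by rewrite -ep -ex.
- by rewrite -ep' -ex'.
Qed.

Section FamiliesOfSolutions.
Context {U : normedModType R}.
Variables (P1 P2 P3 : U -> fps 'rV[R]_d) (X : U -> fps 'cV[R]_d).
Hypotheses (sP1 : smooth_mx P1) (sP2 : smooth_mx P2) (sP3 : smooth_mx P3).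
Hypothesis sX : smooth_mx X.

Lemma bar_exists : exists XB PB, [/\ smooth_mx XB, smooth_mx PB,
  forall u, XB u = Sgrad_p1 S (PB u) (P3 u) (X u) &
  forall u, PB u = Sgrad_x S (P1 u) (P2 u) (XB u)].
Proof.
apply: (smooth_fixpoint (F := fun u p => Sgrad_p1 S p (P3 u) (X u))
  (G := fun u y => Sgrad_x S (P1 u) (P2 u) y)) => [*|*|P sP|Y sY].
- exact: Sgrad_p1_contraction.
- exact: Sgrad_x_contraction.
- exact: smooth_mx_Sgrad_p1.
- exact: smooth_mx_Sgrad_x.
Qed.

Lemma tilde_exists : exists XT PT, [/\ smooth_mx XT, smooth_mx PT,
  forall u, XT u = Sgrad_p2 S (P1 u) (PT u) (X u) &
  forall u, PT u = Sgrad_x S (P2 u) (P3 u) (XT u)].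
Proof.
apply: (smooth_fixpoint (F := fun u p => Sgrad_p2 S (P1 u) p (X u))
  (G := fun u y => Sgrad_x S (P2 u) (P3 u) y)) => [*|*|P sP|Y sY].
- exact: Sgrad_p2_contraction.
- exact: Sgrad_x_contraction.
- exact: smooth_mx_Sgrad_p2.
- exact: smooth_mx_Sgrad_x.
Qed.

(** One summand of the differentiated left-hand side: dx p and dp x, contributed by the two values
    of S, cancel against the derivative of the pairing. *)
Let bar_cancel (K : comNzRingType) (t1 t2 t3 t4 dx dp x p : K) :
  (t1 + t2 + dx * p) + (dp * x + t3 + t4) - (dp * x + p * dx) = t1 + t2 + t3 + t4.
Proof. ring. Qed.

Let tilde_cancel (K : comNzRingType) (t1 t2 t3 t4 dx dp x p : K) :
  (t2 + t3 + dx * p) + (t1 + dp * x + t4) - (dp * x + p * dx) = t1 + t2 + t3 + t4.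
Proof. ring. Qed.

Local Notation D := derive_family.
Local Notation "M `_( i , j )" := (entry_series M i j) (at level 8).

(* The derivatives of the auxiliary series cancel: they are critical points of
   the combination of values of S. *)
Lemma derive_bar_value XB PB w u :
  smooth_mx XB -> smooth_mx PB ->
  (forall u, XB u = Sgrad_p1 S (PB u) (P3 u) (X u)) ->
  (forall u, PB u = Sgrad_x S (P1 u) (P2 u) (XB u)) ->
  D w (fun u => Sval S (P1 u) (P2 u) (XB u) + Sval S (PB u) (P3 u) (X u)
    - fps_pairing (PB u) (XB u) : fps R) u =
  \sum_k (
    D w (fun u => (P1 u)`_(0, k)) u * (Sgrad_p1 S (P1 u) (P2 u) (XB u))`_(k, 0) +
    D w (fun u => (P2 u)`_(0, k)) u * (Sgrad_p2 S (P1 u) (P2 u) (XB u))`_(k, 0) +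
    D w (fun u => (P3 u)`_(0, k)) u * (Sgrad_p2 S (PB u) (P3 u) (X u))`_(k, 0) +
    D w (fun u => (X u)`_(k, 0)) u * (Sgrad_x S (PB u) (P3 u) (X u))`_(0, k)).
Proof.
move=> sXB sPB eX eP.
have s1 := smooth_family_Sval sS sP1 sP2 sXB.
have s2 := smooth_family_Sval sS sPB sP3 sX.
have s3 := smooth_family_pairing sPB sXB.
rewrite derive_familyB //; last exact: smooth_familyD.
rewrite derive_familyD // !derive_family_Sval // derive_family_pairing //.
rewrite -big_split -sumrB; apply: eq_bigr => k _ /=.
(* By the defining equations, the gradients multiplying the derivatives of [XB] and [PB] are [PB]
   and [XB] themselves. *)
rewrite -(eX u) -(eP u); exact: bar_cancel.
Qed.

Lemma derive_tilde_value XT PT w u :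
  smooth_mx XT -> smooth_mx PT ->
  (forall u, XT u = Sgrad_p2 S (P1 u) (PT u) (X u)) ->
  (forall u, PT u = Sgrad_x S (P2 u) (P3 u) (XT u)) ->
  D w (fun u => Sval S (P2 u) (P3 u) (XT u) + Sval S (P1 u) (PT u) (X u)
    - fps_pairing (PT u) (XT u) : fps R) u =
  \sum_k (
    D w (fun u => (P1 u)`_(0, k)) u * (Sgrad_p1 S (P1 u) (PT u) (X u))`_(k, 0) +
    D w (fun u => (P2 u)`_(0, k)) u * (Sgrad_p1 S (P2 u) (P3 u) (XT u))`_(k, 0) +
    D w (fun u => (P3 u)`_(0, k)) u * (Sgrad_p2 S (P2 u) (P3 u) (XT u))`_(k, 0) +
    D w (fun u => (X u)`_(k, 0)) u * (Sgrad_x S (P1 u) (PT u) (X u))`_(0, k)).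
Proof.
move=> sXT sPT eX eP.
have s1 := smooth_family_Sval sS sP2 sP3 sXT.
have s2 := smooth_family_Sval sS sP1 sPT sX.
have s3 := smooth_family_pairing sPT sXT.
rewrite derive_familyB //; last exact: smooth_familyD.
rewrite derive_familyD // !derive_family_Sval // derive_family_pairing //.
rewrite -big_split -sumrB; apply: eq_bigr => k _ /=.
rewrite -(eX u) -(eP u); exact: tilde_cancel.
Qed.

End FamiliesOfSolutions.

End Legendre.

(** * The differentiated SGA equation *)

Section SGAGradients.
Context {R : realType} {d : nat}.
Variable S : fps (B2 R d -> R^o).
Hypothesis hS : deformation S.

Let sS := deformation_smooth hS.
Let S0E := deformation_S0 hS.

Local Notation U := (@B3 R d).
Local Notation eU := (@B3_coordinates R d).
Local Notation "M `_( i , j )" := (entry_series M i j) (at level 8).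

Lemma coordinate_extensionality (A1 A2 A3 A4 C1 C2 C3 C4 : 'I_d -> fps R) :
  (forall w : U,
    \sum_k (fps_const (w.1.1.1 0 k) * A1 k + fps_const (w.1.1.2 0 k) * A2 k +
            fps_const (w.1.2 0 k) * A3 k + fps_const (w.2 k 0) * A4 k) =
    \sum_k (fps_const (w.1.1.1 0 k) * C1 k + fps_const (w.1.1.2 0 k) * C2 k +
            fps_const (w.1.2 0 k) * C3 k + fps_const (w.2 k 0) * C4 k)) ->
  [/\ A1 =1 C1, A2 =1 C2, A3 =1 C3 & A4 =1 C4].
Proof.
have c0 : fps_const (0 : R) = 0 by apply/funext => -[].
have c1 : fps_const (1 : R) = 1 by [].
have row (A : 'I_d -> fps R) k :
    \sum_j fps_const ((delta_mx 0 k : 'rV[R]_d) 0 j) * A j = A k.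
  rewrite (bigD1 k) //= big1 => [|j jk]; rewrite mxE ?eqxx ?c1 ?mul1r ?addr0 //.
  by rewrite (negbTE jk) c0 mul0r.
have col (A : 'I_d -> fps R) k :
    \sum_j fps_const ((delta_mx k 0 : 'cV[R]_d) j 0) * A j = A k.
  rewrite (bigD1 k) //= big1 => [|j jk]; rewrite mxE ?eqxx ?c1 ?mul1r ?addr0 //.
  by rewrite (negbTE jk) c0 mul0r.
have r0 (A : 'I_d -> fps R) : \sum_j fps_const ((0 : 'rV[R]_d) 0 j) * A j = 0.
  by rewrite big1 // => j _; rewrite mxE c0 mul0r.
have l0 (A : 'I_d -> fps R) : \sum_j fps_const ((0 : 'cV[R]_d) j 0) * A j = 0.
  by rewrite big1 // => j _; rewrite mxE c0 mul0r.
move=> H; split=> k.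
- have := H (delta_mx 0 k, 0, 0, 0); rewrite !big_split /=.
  by rewrite !row !r0 !l0 !addr0.
- have := H (0, delta_mx 0 k, 0, 0); rewrite !big_split /=.
  by rewrite !row !r0 !l0 !addr0 !add0r.
- have := H (0, 0, delta_mx 0 k, 0); rewrite !big_split /=.
  by rewrite !row !r0 !l0 !addr0 !add0r.
- have := H (0, 0, 0, delta_mx k 0); rewrite !big_split /=.
  by rewrite !col !r0 !add0r.
Qed.

Let L1 : {linear U -> 'rV[R]_d} := (fst \o (fst \o fst)).
Let L2 : {linear U -> 'rV[R]_d} := (snd \o (fst \o fst)).
Let L3 : {linear U -> 'rV[R]_d} := (snd \o fst).
Let Lx : {linear U -> 'cV[R]_d} := snd.

Let cont_fst (V W : normedModType R) : continuous (@fst V W).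
Proof. by move=> u; apply: cvg_fst. Qed.
Let cont_snd (V W : normedModType R) : continuous (@snd V W).
Proof. by move=> u; apply: cvg_snd. Qed.

Let cL1 : continuous L1.
Proof. by move=> u; do 2?apply: continuous_comp; apply: cont_fst. Qed.
Let cL2 : continuous L2.
Proof.
move=> u; apply: continuous_comp; last exact: cont_snd.
by apply: continuous_comp; apply: cont_fst.
Qed.
Let cL3 : continuous L3.
Proof. by move=> u; apply: continuous_comp; [apply: cont_fst | apply: cont_snd]. Qed.
Let cLx : continuous Lx. Proof. exact: cont_snd. Qed.

(** Solutions at formal arguments are produced by substitution into the smooth families of solutions
    at constant arguments, hence the existential form. Uniqueness later extends the identities to
    every solution. *)
Lemma SGA_gradients_exist (p1 p2 p3 : fps 'rV[R]_d) (x : fps 'cV[R]_d) :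
  exists xb pb xt pt,
  [/\ [/\ xb = Sgrad_p1 S pb p3 x, pb = Sgrad_x S p1 p2 xb,
          xt = Sgrad_p2 S p1 pt x & pt = Sgrad_x S p2 p3 xt],
      Sgrad_p1 S p1 p2 xb = Sgrad_p1 S p1 pt x,
      Sgrad_p2 S p1 p2 xb = Sgrad_p1 S p2 p3 xt,
      Sgrad_p2 S pb p3 x = Sgrad_p2 S p2 p3 xt &
      Sgrad_x S pb p3 x = Sgrad_x S p1 pt x].
Proof.
pose P1 (u : U) := fps_const (L1 u); pose P2 (u : U) := fps_const (L2 u).
pose P3 (u : U) := fps_const (L3 u); pose X (u : U) := fps_const (Lx u).
have sP1 : smooth_mx P1 := smooth_mx_linear cL1.
have sP2 : smooth_mx P2 := smooth_mx_linear cL2.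
have sP3 : smooth_mx P3 := smooth_mx_linear cL3.
have sX : smooth_mx X := smooth_mx_linear cLx.
have [XB [PB [sXB sPB eXB ePB]]] := bar_exists sS S0E sP1 sP2 sP3 sX.
have [XT [PT [sXT sPT eXT ePT]]] := tilde_exists sS S0E sP1 sP2 sP3 sX.
have valE : (fun u => Sval S (P1 u) (P2 u) (XB u) + Sval S (PB u) (P3 u) (X u)
      - fps_pairing (PB u) (XB u) : fps R) =
    (fun u => Sval S (P2 u) (P3 u) (XT u) + Sval S (P1 u) (PT u) (X u)
      - fps_pairing (PT u) (XT u) : fps R).
  apply/funext => u; apply/funext => n.
  exact: (deformation_SGA hS (eXB u) (ePB u) (eXT u) (ePT u)).
have grads u : [/\
    Sgrad_p1 S (P1 u) (P2 u) (XB u) = Sgrad_p1 S (P1 u) (PT u) (X u),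
    Sgrad_p2 S (P1 u) (P2 u) (XB u) = Sgrad_p1 S (P2 u) (P3 u) (XT u),
    Sgrad_p2 S (PB u) (P3 u) (X u) = Sgrad_p2 S (P2 u) (P3 u) (XT u) &
    Sgrad_x S (PB u) (P3 u) (X u) = Sgrad_x S (P1 u) (PT u) (X u)].
  have [|E1 E2 E3 E4] := @coordinate_extensionality
    (fun k => (Sgrad_p1 S (P1 u) (P2 u) (XB u))`_(k, 0))
    (fun k => (Sgrad_p2 S (P1 u) (P2 u) (XB u))`_(k, 0))
    (fun k => (Sgrad_p2 S (PB u) (P3 u) (X u))`_(k, 0))
    (fun k => (Sgrad_x S (PB u) (P3 u) (X u))`_(0, k))
    (fun k => (Sgrad_p1 S (P1 u) (PT u) (X u))`_(k, 0))
    (fun k => (Sgrad_p1 S (P2 u) (P3 u) (XT u))`_(k, 0))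
    (fun k => (Sgrad_p2 S (P2 u) (P3 u) (XT u))`_(k, 0))
    (fun k => (Sgrad_x S (P1 u) (PT u) (X u))`_(0, k)).
    move=> w.
    have := derive_bar_value sS sP1 sP2 sP3 sX w u sXB sPB eXB ePB.
    rewrite valE (derive_tilde_value sS sP1 sP2 sP3 sX w u sXT sPT eXT ePT).
    have d1 k := derive_family_linear cL1 w u 0 k.
    have d2 k := derive_family_linear cL2 w u 0 k.
    have d3 k := derive_family_linear cL3 w u 0 k.
    have dx k := derive_family_linear cLx w u k 0.
    under eq_bigr do rewrite d1 d2 d3 dx.
    under [X in _ = X -> _]eq_bigr do rewrite d1 d2 d3 dx.
    by move=> ->.
  by split; apply: entry_series_ext => i j; rewrite !ord1;
    [apply: E1 | apply: E2 | apply: E3 | apply: E4].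
have g1 u : Sgrad_p1 S (P1 u) (P2 u) (XB u) = Sgrad_p1 S (P1 u) (PT u) (X u).
  by case: (grads u).
have g2 u : Sgrad_p2 S (P1 u) (P2 u) (XB u) = Sgrad_p1 S (P2 u) (P3 u) (XT u).
  by case: (grads u).
have g3 u : Sgrad_p2 S (PB u) (P3 u) (X u) = Sgrad_p2 S (P2 u) (P3 u) (XT u).
  by case: (grads u).
have g4 u : Sgrad_x S (PB u) (P3 u) (X u) = Sgrad_x S (P1 u) (PT u) (X u).
  by case: (grads u).
(* The formal point of B_3 at which the pointwise identities are evaluated; the projections of B_3
   substituted at b return p1, p2, p3, x. *)
pose b : fps U := fun n => (p1 n, p2 n, p3 n, x n).
have bP1 : subst_mx P1 b = p1 by exact: (subst_mx_linear eU cL1).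
have bP2 : subst_mx P2 b = p2 by exact: (subst_mx_linear eU cL2).
have bP3 : subst_mx P3 b = p3 by exact: (subst_mx_linear eU cL3).
have bX : subst_mx X b = x by exact: (subst_mx_linear eU cLx).
have sub m n (M N : U -> fps 'M[R]_(m, n)) :
  (forall u, M u = N u) -> subst_mx M b = subst_mx N b by move=> /funext ->.
clearbody b; subst p1 p2 p3 x.
exists (subst_mx XB b), (subst_mx PB b), (subst_mx XT b), (subst_mx PT b).
split; [split|..].
- exact: etrans (sub _ _ _ _ eXB) (subst_Sgrad_p1 sS eU sPB sP3 sX b).
- exact: etrans (sub _ _ _ _ ePB) (subst_Sgrad_x sS eU sP1 sP2 sXB b).
- exact: etrans (sub _ _ _ _ eXT) (subst_Sgrad_p2 sS eU sP1 sPT sX b).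
- exact: etrans (sub _ _ _ _ ePT) (subst_Sgrad_x sS eU sP2 sP3 sXT b).
- exact: etrans (esym (subst_Sgrad_p1 sS eU sP1 sP2 sXB b))
    (etrans (sub _ _ _ _ g1) (subst_Sgrad_p1 sS eU sP1 sPT sX b)).
- exact: etrans (esym (subst_Sgrad_p2 sS eU sP1 sP2 sXB b))
    (etrans (sub _ _ _ _ g2) (subst_Sgrad_p1 sS eU sP2 sP3 sXT b)).
- exact: etrans (esym (subst_Sgrad_p2 sS eU sPB sP3 sX b))
    (etrans (sub _ _ _ _ g3) (subst_Sgrad_p2 sS eU sP2 sP3 sXT b)).
- exact: etrans (esym (subst_Sgrad_x sS eU sPB sP3 sX b))
    (etrans (sub _ _ _ _ g4) (subst_Sgrad_x sS eU sP1 sPT sX b)).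
Qed.

Lemma SGA_gradients (p1 p2 p3 : fps 'rV[R]_d) (x : fps 'cV[R]_d) xb pb xt pt :
  xb = Sgrad_p1 S pb p3 x -> pb = Sgrad_x S p1 p2 xb ->
  xt = Sgrad_p2 S p1 pt x -> pt = Sgrad_x S p2 p3 xt ->
  [/\ Sgrad_p1 S p1 p2 xb = Sgrad_p1 S p1 pt x,
      Sgrad_p2 S p1 p2 xb = Sgrad_p1 S p2 p3 xt,
      Sgrad_p2 S pb p3 x = Sgrad_p2 S p2 p3 xt &
      Sgrad_x S pb p3 x = Sgrad_x S p1 pt x].
Proof.
move=> exb epb ext ept.
have [xb' [pb' [xt' [pt' [[exb' epb' ext' ept'] E1 E2 E3 E4]]]]] :=
  SGA_gradients_exist p1 p2 p3 x.
have [-> ->] := bar_unique sS S0E exb epb exb' epb'.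
by have [-> ->] := tilde_unique sS S0E ext ept ext' ept'.
Qed.

Lemma SGA_solutions (p1 p2 p3 : fps 'rV[R]_d) (x : fps 'cV[R]_d) :
  exists xb pb xt pt,
  [/\ xb = Sgrad_p1 S pb p3 x, pb = Sgrad_x S p1 p2 xb,
      xt = Sgrad_p2 S p1 pt x & pt = Sgrad_x S p2 p3 xt].
Proof.
have [xb [pb [xt [pt [E _ _ _ _]]]]] := SGA_gradients_exist p1 p2 p3 x.
by exists xb, pb, xt, pt.
Qed.

End SGAGradients.

(** * The groupoid *)

Section Vanishing.
Context {R : realType} {V : normedModType R}.
Implicit Types (f : V -> R^o) (a : fps V).

Section Subspace.
Variable W : V -> Prop.
Hypothesis WZD : forall c u v, W u -> W v -> W (c *: u + v).

Lemma derive_vanish f v b : (forall b, W b -> f b = 0) -> W v -> W b ->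
  'D_v f b = 0.
Proof.
move=> f0 Wv Wb; rewrite /derive.
rewrite (_ : (fun h => _) = fun=> 0) ?lim_cst //.
by apply/funext => h /=; rewrite !f0 ?subr0 ?scaler0 //; apply: WZD.
Qed.

(** All directions in the expansion are coefficients of a, hence tangent to W, and derivatives of f
    along W vanish on W. *)
Lemma taylor_vanish f a : (forall b, W b -> f b = 0) -> (forall n, W (a n)) ->
  taylor f a = 0 :> fps R.
Proof.
move=> f0 Wa; apply/funext => n.
have D0 N (k : seq 'I_N) b : W b ->
    dderivs [seq a (j : nat) | j : 'I_N <- k] f b = 0.
  by elim: k b => [|j k IH] b Wb; [apply: f0 | apply: derive_vanish].
rewrite /taylor big1 // => m _; rewrite big1 ?scaler0 // => k _.
exact: D0.
Qed.

Lemma eq_taylor_subspace (e : coordinates V) f g a : smooth f -> smooth g ->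
  (forall b, W b -> f b = g b) -> (forall n, W (a n)) ->
  taylor f a = taylor g a :> fps R.
Proof.
move=> sf sg fg Wa.
rewrite (eq_taylor (g := fun b => (f b - g b) + g b : R^o)) => [|b].
  rewrite (taylorD e) //; last exact: smoothB.
  by rewrite taylor_vanish ?add0r // => b Wb; rewrite fg ?subrr.
by rewrite subrK.
Qed.

End Subspace.

Lemma fps_eval_vanish (F : fps (V -> R^o)) a :
  (forall n, taylor (F n) a = 0 :> fps R) -> fps_eval F a = 0 :> fps R.
Proof.
by move=> F0; apply/funext => n; rewrite /fps_eval big1 // => i _; rewrite F0.
Qed.

Lemma fps_eval_head (F : fps (V -> R^o)) a :
  (forall n, taylor (F n.+1) a = 0 :> fps R) ->
  fps_eval F a = taylor (F 0%N) a :> fps R.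
Proof.
move=> F0; apply/funext => n; rewrite /fps_eval big_ord_recl subn0.
by rewrite big1 ?addr0 // => i _; rewrite lift0 F0.
Qed.

End Vanishing.

Section Diagonal.
Context {R : realType} {d : nat}.
Implicit Types (P : mpoly (d + d) R) (p q : 'rV[R]_d).

Let deg1 (m : multinom (d + d)) : nat := (\sum_(j < d) m (lshift d j))%N.

Lemma eval_pq_oppl P q :
  eval_pq P (- q) q =
  \sum_(m <- msupp P) (-1) ^+ deg1 m *
    (mcoeff m P * \prod_i row_mx q q 0 i ^+ m i).
Proof.
rewrite /eval_pq mevalE; apply: eq_bigr => m _.
rewrite mulrCA; congr (_ * _); rewrite !big_split_ord /= mulrA; congr (_ * _).
  rewrite expr_sum -big_split; apply: eq_bigr => j _ /=.
  by rewrite !row_mxEl mxE -exprMn mulN1r.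
by apply: eq_bigr => j _; rewrite !row_mxEr.
Qed.

(* Replacing p by -p multiplies the part of degree i in p by (-1)^i. *)
Lemma eval_pq_antidiagonal P q :
  (forall i, eval_pq (fst_homog i P) q q = 0) -> eval_pq P (- q) q = 0.
Proof.
move=> P0; rewrite eval_pq_oppl.
(* N exceeds the degree in p of every monomial in the support, so the degrees index a finite type
   and [inord] is faithful on them. *)
pose N := (\max_(m <- msupp P) deg1 m).+1.
rewrite big_seq.
rewrite (partition_big (fun m => inord (deg1 m) : 'I_N) xpredT) //=.
rewrite big1 // => i _.
transitivity ((-1) ^+ i * eval_pq (fst_homog i P) q q); last by rewrite P0 mulr0.
rewrite /eval_pq /fst_homog (raddf_sum (meval _)) /= mulr_sumr.
rewrite [in RHS]big_seq_cond; apply: eq_big => m.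
  case mP: (m \in _) => //=; rewrite -val_eqE /= inordK // ltnS.
  by apply: leq_bigmax_seq => //; rewrite mP.
case/andP=> mP; rewrite -val_eqE /= inordK; last first.
  by rewrite ltnS; apply: leq_bigmax_seq.
by move=> /eqP <-; rewrite mevalZ mevalX.
Qed.

End Diagonal.

Section Groupoid.
Context {R : realType} {d : nat}.
Variable S : fps (B2 R d -> R^o).
Hypothesis hS : natural_deformation S.

Let dS := natural_deformation_of hS.
Let sS := deformation_smooth dS.
Let S0E := deformation_S0 dS.
Local Notation rV := 'rV[R]_d.
Local Notation cV := 'cV[R]_d.
Local Notation zero := (@fps_zero rV).
Local Notation opp := (@fps_opp rV).

Lemma natural_antidiagonal n (p : rV) (x : cV) : S n (p, - p, x) = 0.
Proof.
case: n => [|n].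
  by rewrite S0E addrN /pairing mul0mx mxE.
have [P hP] := natural_poly hS (ltn0Sn n) x.
(* The pair (p, -p) is read as (-q, q) with q = -p. *)
rewrite hP -{1}[p]opprK; apply: eval_pq_antidiagonal => i.
exact: (natural_diag hS (ltn0Sn n) hP).
Qed.

(** [W1], [W2] and [W3] are the subspaces p2 = 0, p1 = 0 and p1 + p2 = 0, which govern right units,
    left units and inverses. *)
Let W1 (b : B2 R d) := b.1.2 = 0.
Let W2 (b : B2 R d) := b.1.1 = 0.
Let W3 (b : B2 R d) := b.1.2 = - b.1.1.

Let W1ZD c u v : W1 u -> W1 v -> W1 (c *: u + v).
Proof. by rewrite /W1 /= => -> ->; rewrite scaler0 addr0. Qed.
Let W2ZD c u v : W2 u -> W2 v -> W2 (c *: u + v).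
Proof. by rewrite /W2 /= => -> ->; rewrite scaler0 addr0. Qed.
Let W3ZD c u v : W3 u -> W3 v -> W3 (c *: u + v).
Proof. by rewrite /W3 /= => -> ->; rewrite scalerN opprD. Qed.

Let S_W1 n b : W1 b -> S n.+1 b = 0.
Proof.
case: b => -[p q] x; rewrite /W1 /= => ->.
by have [] := natural_vanish hS (ltn0Sn n) p x.
Qed.
Let S_W2 n b : W2 b -> S n.+1 b = 0.
Proof.
case: b => -[p q] x; rewrite /W2 /= => ->.
by have [] := natural_vanish hS (ltn0Sn n) q x.
Qed.
Let S_W3 n b : W3 b -> S n b = 0.
Proof. by case: b => -[p q] x; rewrite /W3 /= => ->; apply: natural_antidiagonal. Qed.

(** The directions p1 and x are tangent to p2 = 0, so only S_0 contributes to these two gradients.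
    The transversal p2-gradient keeps its higher terms and is the source map. *)
Lemma Sgrad_p1_r0 p x : Sgrad_p1 S p zero x = x.
Proof.
apply: entry_series_ext => k j; rewrite Sgrad_p1_series // ord1.
rewrite fps_eval_head ?(taylor_dS_p1_0 S0E) // => n.
apply: (taylor_vanish W1ZD) => // b Wb.
exact: (derive_vanish W1ZD (@S_W1 n)).
Qed.

Lemma Sgrad_x_r0 p x : Sgrad_x S p zero x = p.
Proof.
apply: entry_series_ext => j k; rewrite Sgrad_x_series // ord1.
rewrite fps_eval_head ?(taylor_dS_x_0 S0E) => [|n].
  by apply/funext => n; rewrite fpsD /entry_series mxE addr0.
apply: (taylor_vanish W1ZD) => // b Wb.
exact: (derive_vanish W1ZD (@S_W1 n)).
Qed.

Lemma Sgrad_p2_l0 p x : Sgrad_p2 S zero p x = x.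
Proof.
apply: entry_series_ext => k j; rewrite Sgrad_p2_series // ord1.
rewrite fps_eval_head ?(taylor_dS_p2_0 S0E) // => n.
apply: (taylor_vanish W2ZD) => // b Wb.
exact: (derive_vanish W2ZD (@S_W2 n)).
Qed.

Lemma Sgrad_x_l0 p x : Sgrad_x S zero p x = p.
Proof.
apply: entry_series_ext => j k; rewrite Sgrad_x_series // ord1.
rewrite fps_eval_head ?(taylor_dS_x_0 S0E) => [|n].
  by apply/funext => n; rewrite fpsD /entry_series mxE add0r.
apply: (taylor_vanish W2ZD) => // b Wb.
exact: (derive_vanish W2ZD (@S_W2 n)).
Qed.

Lemma Sgrad_x_antidiagonal p x : Sgrad_x S p (opp p) x = zero.
Proof.
apply: entry_series_ext => j k; rewrite Sgrad_x_series //.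
rewrite fps_eval_vanish => [|n]; first by apply/funext => n; rewrite /entry_series mxE.
apply: (taylor_vanish W3ZD) => // b Wb.
by apply: (derive_vanish W3ZD (@S_W3 n)) => //; rewrite /W3 /= oppr0.
Qed.

(** The difference of the two partial derivatives is the derivative in the direction (v, -v, 0),
    which is tangent to p1 + p2 = 0. *)
Lemma Sgrad_p12_antidiagonal p x :
  Sgrad_p1 S p (opp p) x = Sgrad_p2 S p (opp p) x.
Proof.
apply: entry_series_ext => k j; set a := fps_B2 p (opp p) x.
apply: (etrans (Sgrad_p1_series sS _ _ _ _ _)).
apply: etrans (esym (Sgrad_p2_series sS _ _ _ _ _)).
suff E i : taylor (dS_p1 S k i) a = taylor (dS_p2 S k i) a.
  apply/funext => n; apply: eq_bigr => i _.
  exact: (congr1 (@^~ (n - i)%N) (E i)).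
apply: (eq_taylor_subspace W3ZD (B2_coordinates d)
  (smooth_dS_p1 sS k i) (smooth_dS_p2 sS k i)) => [b Wb|n]; last by [].
apply/eqP; rewrite -subr_eq0; apply/eqP.
transitivity ('D_((delta_mx 0 k, - delta_mx 0 k, 0) : B2 R d) (S i) b).
  have dSb := smooth_diff (sS i) b.
  rewrite /dS_p1 /dS_p2 !deriveE // -linearB; congr ('d _ _ _).
  by congr (_, _, _); rewrite ?subr0 ?sub0r ?oppr0 ?addr0.
by apply: (derive_vanish W3ZD (@S_W3 i)).
Qed.

(** Since the p1-gradient of S is x plus terms with a factor h, solving for x is a fixed-point
    problem for this contraction. *)
Let solver p1 p2 (y x : fps cV) : fps cV :=
  fun n => y n - (Sgrad_p1 S p1 p2 x n - x n).

Let solver_contraction p1 p2 y : fps_contraction (solver p1 p2 y).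
Proof.
move=> N a b ab n nN; congr (_ - _).
exact: (Sgrad_p1_local sS S0E (fun _ _ => erefl) (fun _ _ => erefl) ab).
Qed.

Let solverP p1 p2 y x : solver p1 p2 y x = x <-> Sgrad_p1 S p1 p2 x = y.
Proof.
split=> [E|E]; apply/funext => n.
  have /eqP := congr1 (@^~ n) E; rewrite /solver opprB addrCA addrC -subr_eq0.
  by rewrite addrK subr_eq0 => /eqP.
by rewrite /solver E opprB addrCA subrr addr0.
Qed.

Lemma Sgrad_p1_surj p1 p2 y : exists x, Sgrad_p1 S p1 p2 x = y.
Proof.
exists (fps_fix (solver p1 p2 y) 0); apply/solverP.
exact/fps_fixE/solver_contraction.
Qed.

Lemma Sgrad_p1_inj p1 p2 : injective (Sgrad_p1 S p1 p2).
Proof.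
move=> x y E; apply: (fps_contraction_unique
    (@solver_contraction p1 p2 (Sgrad_p1 S p1 p2 y))).
  exact/solverP.
exact/solverP.
Qed.

(** The second gradient identity for the triple (p1, 0, p2): a zero middle momentum makes the
    auxiliary momenta equal to p1 and p2. *)
Lemma composable p1 p2 x :
  Sgrad_p2 S p1 zero (Sgrad_p1 S p1 p2 x) = Sgrad_p1 S zero p2 (Sgrad_p2 S p1 p2 x).
Proof.
have [_ E _ _] := SGA_gradients (p1 := p1) (p2 := zero) (p3 := p2) (x := x) dS
  erefl (esym (Sgrad_x_r0 p1 _)) erefl (esym (Sgrad_x_l0 p2 _)).
exact: E.
Qed.

(** For the triple (p, -p, p) both auxiliary momenta vanish, and the first and third gradient
    identities reduce to values on p2 = 0 and p1 = 0. *)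
Lemma antidiagonal_gradients p x :
  Sgrad_p1 S p (opp p) (Sgrad_p1 S zero p x) = x /\
  Sgrad_p2 S (opp p) p (Sgrad_p2 S p zero x) = x.
Proof.
have oppK : opp (opp p) = p by apply/funext => n; rewrite /fps_opp opprK.
have xo y : zero = Sgrad_x S (opp p) p y.
  by rewrite -{2}oppK Sgrad_x_antidiagonal.
have [E1 _ E3 _] := SGA_gradients (p1 := p) (p2 := opp p) (p3 := p) (x := x) dS
  erefl (esym (Sgrad_x_antidiagonal p _)) erefl (xo _).
split; first exact: etrans E1 (Sgrad_p1_r0 p x).
exact: etrans (esym E3) (Sgrad_p2_l0 p x).
Qed.

(** The intermediate product k is ([pb], [xb]) on one side and ([pt], [xt]) on the other. That k is
    at once a product and a factor of the next product amounts to the defining equations of these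
    series, and the gradient identities match the remaining components. *)
Lemma mul_h_assoc g1 g2 g3 g :
  (exists2 k, mul_h S g1 g2 k & mul_h S k g3 g) <->
  (exists2 k, mul_h S g2 g3 k & mul_h S g1 k g).
Proof.
split.
  case=> k [p [q [xb [Eg1 Eg2 Ek]]]] [pb [r [x [Ek' Eg3 Eg]]]].
  move: Ek'; rewrite Ek => -[epb exb].
  have [_ [_ [xt [pt [_ _ ext ept]]]]] := SGA_solutions dS p q r x.
  have [E1 E2 E3 E4] := SGA_gradients dS exb (esym epb) ext ept.
  exists (pt, xt).
    exists q, r, xt; split.
    - exact: etrans Eg2 (congr1 (pair q) E2).
    - exact: etrans Eg3 (congr1 (pair r) E3).
    - exact: (congr1 (pair^~ xt) ept).
  exists p, pt, x; split.
  - exact: etrans Eg1 (congr1 (pair p) E1).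
  - exact: (congr1 (pair pt) ext).
  - exact: etrans Eg (congr1 (pair^~ x) E4).
case=> k [q [r [xt [Eg2 Eg3 Ek]]]] [p [pt [x [Eg1 Ek' Eg]]]].
move: Ek'; rewrite Ek => -[ept ext].
have [xb [pb [_ [_ [exb epb _ _]]]]] := SGA_solutions dS p q r x.
have [E1 E2 E3 E4] := SGA_gradients dS exb epb ext (esym ept).
exists (pb, xb).
  exists p, q, xb; split.
  - exact: etrans Eg1 (congr1 (pair p) (esym E1)).
  - exact: etrans Eg2 (congr1 (pair q) (esym E2)).
  - exact: (congr1 (pair^~ xb) epb).
exists pb, r, x; split.
- exact: (congr1 (pair pb) exb).
- exact: etrans Eg3 (congr1 (pair r) (esym E3)).
- exact: etrans Eg (congr1 (pair^~ x) (esym E4)).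
Qed.

(** The first gradient identity for the triple (0, p, q). *)
Lemma mul_h_target g1 g2 g : mul_h S g1 g2 g -> target_h S g = target_h S g1.
Proof.
case=> p [q [x [-> _ ->]]]; rewrite /target_h /=.
have [E _ _ _] := SGA_gradients (p1 := zero) (p2 := p) (p3 := q) (x := x) dS
  erefl (esym (Sgrad_x_l0 p _)) (esym (Sgrad_p2_l0 _ x)) erefl.
exact: esym E.
Qed.

(** The third gradient identity for the triple (p, q, 0). *)
Lemma mul_h_source g1 g2 g : mul_h S g1 g2 g -> source_h S g = source_h S g2.
Proof.
case=> p [q [x [_ -> ->]]]; rewrite /source_h /=.
have [_ _ E _] := SGA_gradients (p1 := p) (p2 := q) (p3 := zero) (x := x) dS
  (esym (Sgrad_p1_r0 _ x)) erefl erefl (esym (Sgrad_x_r0 q _)).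
exact: E.
Qed.

Lemma mul_h_defined g1 g2 :
  (exists g, mul_h S g1 g2 g) <-> source_h S g1 = target_h S g2.
Proof.
split=> [[g [p [q [x [-> -> _]]]]]|].
  exact: composable.
case: g1 g2 => p x1 [q x2]; rewrite /source_h /target_h /= => E.
have [x ex] := Sgrad_p1_surj p q x1.
exists (Sgrad_x S p q x, x), p, q, x; split=> //; first by rewrite ex.
(* x was chosen to match the first factor only. The second one matches because both candidates have
   the same image under the injective map [Sgrad_p1 S zero q], by [composable] and the
   hypothesis. *)
congr pair; apply: (@Sgrad_p1_inj zero q).
by rewrite -E -ex; apply: composable.
Qed.

Lemma mul_h_functional g1 g2 g g' :
  mul_h S g1 g2 g -> mul_h S g1 g2 g' -> g = g'.
Proof.
case=> p [q [x [-> -> ->]]] [p' [q' [x' [[pp ex] [qq _] ->]]]].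
by subst p' q'; rewrite (Sgrad_p1_inj ex).
Qed.

Lemma mul_h_groupoid :
  groupoid_axioms (@unit_h R d) (@inv_h R d) (source_h S) (target_h S) (mul_h S).
Proof.
have invl g : mul_h S (inv_h g) g (unit_h (source_h S g)).
  case: g => p x; exists (opp p), p, (Sgrad_p2 S p zero x).
  have [_ E] := antidiagonal_gradients p x.
  have oppK : opp (opp p) = p by apply/funext => n; rewrite /fps_opp opprK.
  have D := Sgrad_p12_antidiagonal (opp p) (Sgrad_p2 S p zero x).
  have X := Sgrad_x_antidiagonal (opp p) (Sgrad_p2 S p zero x).
  rewrite oppK in D X.
  by split; rewrite /inv_h /unit_h /source_h /= ?D ?E ?X.
split.
- exact: mul_h_functional.
- exact: mul_h_defined.
- exact: mul_h_assoc.
- exact: mul_h_target.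
- exact: mul_h_source.
- case=> p x; exists zero, p, x.
  by split; rewrite /unit_h /target_h /= ?Sgrad_p2_l0 ?Sgrad_x_l0.
- case=> p x; exists p, zero, x.
  by split; rewrite /unit_h /source_h /= ?Sgrad_p1_r0 ?Sgrad_x_r0.
(* The product of the inverse of g with g exists, which forces its source and target to match. *)
- by move=> g; apply/mul_h_defined; exists (unit_h (source_h S g)).
- exact: invl.
case=> p x; exists p, (opp p), (Sgrad_p1 S zero p x).
have [E _] := antidiagonal_gradients p x.
have D := Sgrad_p12_antidiagonal p (Sgrad_p1 S zero p x).
have X := Sgrad_x_antidiagonal p (Sgrad_p1 S zero p x).
by split; rewrite /inv_h /unit_h /target_h /= -?D ?E ?X.
Qed.

End Groupoid.

(** * The graph of the product is Lagrangian *)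

Section Lagrangian.
Context {R : realType} {d : nat}.
Variable S : fps (B2 R d -> R^o).
Hypothesis sS : forall n, smooth (S n).

Lemma derive_pair (U V W : normedModType R) (f : U -> V) (g : U -> W) b u :
  differentiable f b -> differentiable g b ->
  'D_u (fun x => (f x, g x)) b = ('D_u f b, 'D_u g b).
Proof.
move=> df dg; rewrite deriveE; last exact: differentiable_pair.
by rewrite diff_pair // !deriveE.
Qed.

Lemma derive_const_linear (U V : normedModType R) (L : {linear U -> V}) k b u :
  continuous L ->
  differentiable (fun x => fps_const (L x) k) b /\
  'D_u (fun x => fps_const (L x) k) b = fps_const (L u) k.
Proof.
move=> cL; case: k => [|k] /=.
  by split; [apply: linear_differentiable | apply: derive_linear].
by split; [apply: differentiable_cst | apply: derive_cst].
Qed.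

Lemma derive_grad_p1 n b u :
  differentiable (grad_p1 (S n)) b /\
  'D_u (grad_p1 (S n)) b = \col_i 'D_u (dS_p1 S i n) b.
Proof.
have E i (j : 'I_1) : (fun x => grad_p1 (S n) x i j : R^o) = dS_p1 S i n.
  by apply/funext => x; rewrite mxE.
have dg i j : differentiable (fun x => grad_p1 (S n) x i j : R^o) b.
  by rewrite E; apply/smooth_diff/smooth_dS_p1.
have df : differentiable (grad_p1 (S n)) b.
  by apply: (differentiable_coords (e := col_coordinates d)) => i; apply: dg.
split=> //; rewrite derive_mx; last exact: diff_derivable.
by apply/matrixP => i j; rewrite !mxE E.
Qed.

Lemma derive_grad_p2 n b u :
  differentiable (grad_p2 (S n)) b /\
  'D_u (grad_p2 (S n)) b = \col_i 'D_u (dS_p2 S i n) b.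
Proof.
have E i (j : 'I_1) : (fun x => grad_p2 (S n) x i j : R^o) = dS_p2 S i n.
  by apply/funext => x; rewrite mxE.
have dg i j : differentiable (fun x => grad_p2 (S n) x i j : R^o) b.
  by rewrite E; apply/smooth_diff/smooth_dS_p2.
have df : differentiable (grad_p2 (S n)) b.
  by apply: (differentiable_coords (e := col_coordinates d)) => i; apply: dg.
split=> //; rewrite derive_mx; last exact: diff_derivable.
by apply/matrixP => i j; rewrite !mxE E.
Qed.

Lemma derive_grad_x n b u :
  differentiable (grad_x (S n)) b /\
  'D_u (grad_x (S n)) b = \row_i 'D_u (dS_x S i n) b.
Proof.
have E (j : 'I_1) i : (fun x => grad_x (S n) x j i : R^o) = dS_x S i n.
  by apply/funext => x; rewrite mxE.
have dg j i : differentiable (fun x => grad_x (S n) x j i : R^o) b.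
  by rewrite E; apply/smooth_diff/smooth_dS_x.
have df : differentiable (grad_x (S n)) b.
  by apply: (differentiable_coords (e := row_coordinates d)) => i; apply: dg.
split=> //; rewrite derive_mx; last exact: diff_derivable.
by apply/matrixP => j i; rewrite !mxE E.
Qed.

(** The three blocks of the Hessian of S_n at b, applied to u. *)
Let H1 (u b : B2 R d) n : 'cV[R]_d := \col_i 'D_u (dS_p1 S i n) b.
Let H2 (u b : B2 R d) n : 'cV[R]_d := \col_i 'D_u (dS_p2 S i n) b.
Let Hx (u b : B2 R d) n : 'rV[R]_d := \row_i 'D_u (dS_x S i n) b.

Lemma derive_mul_h_param k b u :
  'D_u (mul_h_param S k) b =
  ((fps_const u.1.1 k, H1 u b k), (fps_const u.1.2 k, H2 u b k),
   (Hx u b k, fps_const u.2 k)).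
Proof.
pose L1 : {linear B2 R d -> 'rV[R]_d} := (fst \o fst).
pose L2 : {linear B2 R d -> 'rV[R]_d} := (snd \o fst).
pose Lx : {linear B2 R d -> 'cV[R]_d} := snd.
have c1 : continuous L1.
  by move=> x; apply: continuous_comp; apply: cvg_fst.
have c2 : continuous L2.
  by move=> x; apply: continuous_comp; [apply: cvg_fst | apply: cvg_snd].
have cx : continuous Lx by move=> x; apply: cvg_snd.
have [d1 D1] := derive_const_linear k b u c1.
have [d2 D2] := derive_const_linear k b u c2.
have [dx Dx] := derive_const_linear k b u cx.
have [g1 G1] := derive_grad_p1 k b u.
have [g2 G2] := derive_grad_p2 k b u.
have [gx Gx] := derive_grad_x k b u.
have e1 := derive_pair u d1 g1; rewrite D1 G1 in e1.
have e2 := derive_pair u d2 g2; rewrite D2 G2 in e2.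
have ex := derive_pair u gx dx; rewrite Dx Gx in ex.
have p1 := differentiable_pair d1 g1; have p2 := differentiable_pair d2 g2.
have px := differentiable_pair gx dx; have p12 := differentiable_pair p1 p2.
exact: etrans (derive_pair u p12 px)
  (congr2 pair (etrans (derive_pair u p1 p2) (congr2 pair e1 e2)) ex).
Qed.

Lemma sum_pairing_constl (p : 'rV[R]_d) (X : fps 'cV[R]_d) n :
  \sum_(k < n.+1) pairing (fps_const p k) (X (n - k)%N) = pairing p (X n).
Proof.
rewrite big_ord_recl subn0 big1 ?addr0 // => i _.
by rewrite /pairing mul0mx mxE.
Qed.

Lemma sum_pairing_constr (P : fps 'rV[R]_d) (x : 'cV[R]_d) n :
  \sum_(k < n.+1) pairing (P (n - k)%N) (fps_const x k) = pairing (P n) x.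
Proof.
rewrite big_ord_recl subn0 big1 ?addr0 // => i _.
by rewrite /pairing mulmx0 mxE.
Qed.

Lemma sum_ord_rev (F : nat -> nat -> R) n :
  \sum_(k < n.+1) F k (n - k)%N = \sum_(k < n.+1) F (n - k)%N k.
Proof.
rewrite (reindex_inj rev_ord_inj); apply: eq_bigr => k _ /=.
by rewrite subSS subKn // -ltnS.
Qed.

Lemma second_derivative n b u v :
  'D_u ('D_v (S n)) b =
  pairing u.1.1 (H1 v b n) + pairing u.1.2 (H2 v b n) + pairing (Hx v b n) u.2.
Proof.
rewrite (derive_coord (B2_coordinates d)); last exact/smooth_diff/smooth_derive.
have h1 k : H1 v b n k 0 = 'D_v (dS_p1 S k n) b by rewrite mxE.
have h2 k : H2 v b n k 0 = 'D_v (dS_p2 S k n) b by rewrite mxE.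
have hx k : Hx v b n 0 k = 'D_v (dS_x S k n) b by rewrite mxE.
have swap w : 'D_w ('D_v (S n)) b = 'D_v ('D_w (S n)) b.
  exact: (congr1 (@^~ b) (derive_smooth_swap _ _ (sS n))).
rewrite !big_sumType /=; congr (_ + _ + _); rewrite /pairing mxE;
  apply: eq_bigr => k _.
- exact: (congr1 (fun t => u.1.1 0 k * t) (etrans (swap _) (esym (h1 k)))).
- exact: (congr1 (fun t => u.1.2 0 k * t) (etrans (swap _) (esym (h2 k)))).
- rewrite [RHS]mulrC.
  exact: (congr1 (fun t => u.2 k 0 * t) (etrans (swap _) (esym (hx k)))).
Qed.

(** The coordinates p1, p2, x live in degree 0, so the convolution collapses and the coefficient of
    h^n involves the gradients of S_n alone. *)
Lemma sum_omega3 (p1 q1 p2 q2 : 'rV[R]_d) (x y : 'cV[R]_d)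
    (X1 Y1 X2 Y2 : fps 'cV[R]_d) (P Q : fps 'rV[R]_d) n :
  \sum_(k < n.+1) omega3
    ((fps_const p1 k, X1 k), (fps_const p2 k, X2 k), (P k, fps_const x k))
    ((fps_const q1 (n - k)%N, Y1 (n - k)%N), (fps_const q2 (n - k)%N, Y2 (n - k)%N),
     (Q (n - k)%N, fps_const y (n - k)%N)) =
  - (pairing p1 (Y1 n) - pairing q1 (X1 n))
  - (pairing p2 (Y2 n) - pairing q2 (X2 n))
  + (pairing (P n) y - pairing (Q n) x).
Proof.
rewrite /omega3 /omega /= !big_split /= !sumrN !big_split /= !sumrN.
rewrite (sum_ord_rev (fun k l => pairing (fps_const q1 l) (X1 k))).
rewrite (sum_ord_rev (fun k l => pairing (fps_const q2 l) (X2 k))).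
rewrite (sum_ord_rev (fun k l => pairing (P k) (fps_const y l))).
by rewrite !sum_pairing_constl !sum_pairing_constr.
Qed.

Let antisym_cancel (a1 a2 a3 b1 b2 b3 : R) : a1 + a2 + a3 = b1 + b2 + b3 ->
  - (a1 - b1) - (a2 - b2) + (b3 - a3) = 0.
Proof. lra. Qed.

(* The pullback is the antisymmetric part of the Hessian of S. *)
Lemma mul_h_lagrangian : formally_lagrangian (mul_h_param S).
Proof.
move=> b u v n; rewrite /pullback_omega3.
under eq_bigr do rewrite !derive_mul_h_param.
rewrite (sum_omega3 _ _ _ _ _ _ (H1 u b) (H1 v b) (H2 u b) (H2 v b) (Hx u b) (Hx v b)).
have swap : 'D_u ('D_v (S n)) b = 'D_v ('D_u (S n)) b.
  exact: (congr1 (@^~ b) (derive_smooth_swap _ _ (sS n))).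
apply: antisym_cancel.
exact: etrans (esym (second_derivative n b u v))
  (etrans swap (second_derivative n b v u)).
Qed.

End Lagrangian.

Theorem proposition1 (R : realType) (d : nat)
    (S : fps (B2 R d -> R^o)) (hS : natural_deformation S) :
  groupoid_axioms (@unit_h R d) (@inv_h R d) (source_h S) (target_h S)
    (mul_h S)
  /\ formally_lagrangian (mul_h_param S).
Proof.
split; first exact: mul_h_groupoid.
exact/mul_h_lagrangian/(deformation_smooth (natural_deformation_of hS)).
Qed.
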